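(* Let $K$ be a field which is not absolutely algebraic. Then there exists a subring $D$ of $K$ which is a UFD and such that: (1) $K$ is algebraic over $D$. (2) $|\mathrm{Irr}(D)|=|K|$. (3) $K$ has at least $|K|$-many maximal subrings up to $D$-algebra isomorphism.
   Context: All rings are commutative with $1\neq 0$; subrings and homomorphisms are unital. An absolutely algebraic field is a field which is algebraic over $\mathbb{F}_p$ for some prime number $p$. $\mathrm{Irr}(D)$ denotes the set of all non-associate irreducible elements of the integral domain $D$ (i.e. a set containing exactly one representative of each associate class of irreducible elements). A proper subring $S$ of a ring $R$ is a maximal subring of $R$ if it is maximal with respect to inclusion among the proper subrings of $R$. For rings $S,T$ containing $D$ as a subring, a $D$-algebra isomorphism $S\to T$ is a ring isomorphism that restricts to the identity on $D$. ''At least $|K|$-many maximal subrings up to $D$-algebra isomorphism'' means at least $|K|$ maximal subrings of $K$ containing $D$, no two of which are isomorphic as $D$-algebras. *)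

(* Defs.v *)
From HB Require Import structures.
From mathcomp Require Import all_boot all_order all_algebra.
From mathcomp Require Import boolp classical_sets functions cardinality.

Set Implicit Arguments.
Unset Strict Implicit.
Unset Printing Implicit Defensive.

Import GRing.Theory.

Local Open Scope classical_set_scope.
Local Open Scope ring_scope.

Definition absolutely_algebraic (K : fieldType) : Prop :=
  exists2 p : nat, p \in [pchar K] &
    forall x : K, algebraicOver (fun c : 'F_p => (c : nat)%:R : K) x.

(* Subrings of a field K are boolean predicates D : {pred K} satisfying
   [GRing.subring_closed D]; they are automatically integral domains. The
   arithmetic notions below are internal to the ring D, not to K. *)

Definition unit_in (K : fieldType) (D : {pred K}) (x : K) : Prop :=
  x \in D /\ exists2 y, y \in D & x * y = 1.

Definition irreducible_in (K : fieldType) (D : {pred K}) (x : K) : Prop :=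
  [/\ x \in D, x != 0, ~ unit_in D x &
      forall a b, a \in D -> b \in D -> x = a * b ->
        unit_in D a \/ unit_in D b].

Definition associates_in (K : fieldType) (D : {pred K}) (x y : K) : Prop :=
  exists2 u, unit_in D u & y = u * x.

Definition is_UFD (K : fieldType) (D : {pred K}) : Prop :=
  [/\ GRing.subring_closed D,
      (forall x, x \in D -> x != 0 -> ~ unit_in D x ->
        exists2 s : seq K,
          (forall a, a \in s -> irreducible_in D a) & x = \prod_(a <- s) a) &
      (forall s t : seq K,
        (forall a, a \in s -> irreducible_in D a) ->
        (forall a, a \in t -> irreducible_in D a) ->
        \prod_(a <- s) a = \prod_(a <- t) a ->
        exists t' : seq K,
          [/\ perm_eq t t', size s = size t' &
              forall i, (i < size s)%N -> associates_in D s`_i t'`_i])].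

(* I is a possible value of Irr(D), which is only defined up to the choice of
   one representative in each associate class. *)
Definition is_Irr (K : fieldType) (D : {pred K}) (I : set K) : Prop :=
  I `<=` irreducible_in D /\
  forall x, irreducible_in D x -> exists! y, I y /\ associates_in D x y.

Definition algebraic_over_subring (K : fieldType) (D : {pred K}) : Prop :=
  forall x : K, exists p : {poly K}, [/\ p \is a polyOver D, p != 0 & root p x].

Definition maximal_subring (K : fieldType) (S : {pred K}) : Prop :=
  [/\ GRing.subring_closed S, exists x, x \notin S &
      forall T : {pred K}, GRing.subring_closed T -> (exists x, x \notin T) ->
        {subset S <= T} -> {subset T <= S}].

(* A map S -> T is represented by a function on K, whose values outside of S
   are irrelevant; f 1 = 1 follows from 1 \in D. *)
Definition algebra_isomorphic (K : fieldType) (D S T : {pred K}) : Prop :=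
  exists f : K -> K,
    [/\ set_bij [set` S] [set` T] f,
        {in S &, {morph f : x y / x + y}},
        {in S &, {morph f : x y / x * y}} &
        {in D, forall x, f x = x}].

(* Main.v *)
From HB Require Import structures.
Require Import Defs.
From mathcomp Require Import all_boot all_order all_algebra.
From mathcomp Require Import boolp classical_sets functions cardinality.

(** Order the factorial subrings of [K] by inert extension: [D <= E], and a
    nonzero product of elements of [E] which lies in [D] has its factors in [D].
    Units and irreducible elements do not change along such extensions, so
    unions of chains are again factorial and Zorn's lemma gives a maximal [D]
    above the prime subring.  If [t] were transcendental over [D], then [D[t]]
    would be a larger one, by Gauss's lemma; hence [K] is algebraic over [D].
    The units of [D] are those of the prime subring, thus finitely many, so
    Euclid's argument yields infinitely many irreducibles, and [|K| = |Irr D|]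
    by cardinal arithmetic.

    For [q] in [Irr D], a subring [S_q] of [K] containing the localization of
    [D] at [q] and maximal for not containing [1/q] is a valuation ring with no
    proper overring but [K].  As [1/r] lies in [S_q] for every other [r] in
    [Irr D], the ring [D] sees which element of [Irr D] is not inverted in
    [S_q], so distinct [S_q] are not isomorphic over [D]. *)

Set Implicit Arguments.
Unset Strict Implicit.
Unset Printing Implicit Defensive.

Import Order.TTheory GRing.Theory Num.Theory.

Local Open Scope classical_set_scope.
Local Open Scope card_scope.
Local Open Scope ring_scope.

(** * Zorn's lemma and cardinal arithmetic *)

(** Zorn's lemma on the subtype of elements satisfying [P]. The empty chain is bounded by [x0], so
    only nonempty chains are asked for a bound. *)
Lemma zorn_preorder (T : Type) (P : T -> Prop) (R : T -> T -> Prop) (x0 : T) :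
  P x0 -> (forall x, R x x) -> (forall x y z, R x y -> R y z -> R x z) ->
  (forall A : set T, A !=set0 -> A `<=` P -> total_on A R ->
     exists2 t, P t & forall s, A s -> R s t) ->
  exists2 t, P t & forall s, P s -> R t s -> R s t.
Proof.
move=> Px0 Rxx Rtr Rch.
pose R' (u v : {x | P x}) := `[< R (sval u) (sval v) >].
have [||A totA|[t Pt] tmax] := @ZL_preorder _ (exist P x0 Px0) R'.
- by move=> u; exact/asboolP.
- by move=> v u w /asboolP uv /asboolP vw; apply/asboolP; exact: Rtr uv vw.
- have [[a Aa]|A0] := pselect (A !=set0); last first.
    by exists (exist P x0 Px0) => s As; case: A0; exists s.
  have [|_ [u _ <-]|_ _ [u Au <-] [v Av <-]|t Pt tub] := Rch (sval @` A).
  + by exists (sval a); exists a.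
  + exact: svalP.
  + by case: (totA _ _ Au Av) => /asboolP; [left|right].
  + exists (exist P t Pt) => s As; apply/asboolP; apply: tub; by exists s.
- exists t => // s Ps Rts.
  by have /asboolP := tmax (exist P s Ps) (introT (asboolP _) Rts).
Qed.

(** Comparability of cardinals: [P] describes graphs of partial injections from [A] to [B]. A
    maximal one is defined on all of [A] or reaches all of [B], since otherwise a missing [a0] could
    be matched with a missing [b0]. *)
Lemma set_inj_total (T : Type) (A B : set T) :
  (exists2 f : T -> T, set_fun A B f & set_inj A f) \/
  (exists2 f : T -> T, set_fun B A f & set_inj B f).
Proof.
pose P (G : set (T * T)) :=
  [/\ (forall a b, G (a, b) -> A a /\ B b),
      (forall a b b', G (a, b) -> G (a, b') -> b = b') &
      (forall a a' b, G (a, b) -> G (a', b) -> a = a')].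
have [F FP Ftot|G [[GAB Gf Gi] Gmax]] := @Zorn_bigcup _ P.
  have join u v : (\bigcup_(X in F) X) u -> (\bigcup_(X in F) X) v ->
      exists X, [/\ F X, X u & X v].
    move=> [X FX Xu] [Y FY Yv].
    by case: (Ftot _ _ FX FY) => XY; [exists Y|exists X]; split=> //; exact: XY.
  split.
  - by move=> a b [X /FP[XAB _ _]] /XAB.
  - move=> a b b' /join/[apply] -[X [/FP[_ Xf _]]]; exact: Xf.
  - move=> a a' b /join/[apply] -[X [/FP[_ _ Xi]]]; exact: Xi.
have [Adom|/existsNP[a0 /not_implyP[Aa0 Na0]]] :=
    pselect (forall a, A a -> exists b, G (a, b)).
  left; have /choice[f fG] a : exists b, A a -> G (a, b).
    by have [/Adom[b]|] := pselect (A a); [exists b|exists a].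
  exists f => [a /fG/GAB[]//|a a' /set_mem Aa /set_mem Aa' ff'].
  by apply: Gi (fG _ Aa) _; rewrite ff'; exact: fG.
have [Bdom|/existsNP[b0 /not_implyP[Bb0 Nb0]]] :=
    pselect (forall b, B b -> exists a, G (a, b)).
  right; have /choice[f fG] b : exists a, B b -> G (a, b).
    by have [/Bdom[a]|] := pselect (B b); [exists a|exists b].
  exists f => [b /fG/GAB[]//|b b' /set_mem Bb /set_mem Bb' ff'].
  by apply: Gf (fG _ Bb) _; rewrite ff'; exact: fG.
case: (Gmax (G `|` [set (a0, b0)])).
  split=> [u Gu|/(_ (a0, b0))H]; first by left.
  by apply: Na0; exists b0; apply: H; right.
split.
- by move=> a b [/GAB//|[-> ->]].
- move=> a b b' [Gab|[ea eb]] [Gab'|[ea' eb']].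
  + exact: Gf Gab Gab'.
  + by case: Na0; exists b; rewrite -ea'.
  + by case: Na0; exists b'; rewrite -ea.
  + by rewrite eb eb'.
- move=> a a' b [Gab|[ea eb]] [Gab'|[ea' eb']].
  + exact: Gi Gab Gab'.
  + by case: Nb0; exists a; rewrite -eb'.
  + by case: Nb0; exists a'; rewrite -eb.
  + by rewrite ea ea'.
Qed.

(** * Pairing functions on infinite types *)

Section PairingFunction.
Variables (T : Type) (f : T * T -> T) (A : set T).
Hypotheses (fA : set_fun (A `*` A) A f) (fI : set_inj (A `*` A) f).

Lemma pairing_inj x y x' y' : A x -> A y -> A x' -> A y' ->
  f (x, y) = f (x', y') -> x = x' /\ y = y'.
Proof.
by move=> Ax Ay Ax' Ay' /fI; rewrite !inE => /(_ _ _)/pair_equal_spec; apply.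
Qed.

(* [x] is coded by [f (a0, x)] inside [A] and by [f (a1, h x)] outside. *)
Lemma pairing_absorb (C : set T) (h : T -> T) :
  (exists a0 a1, [/\ A a0, A a1 & a0 <> a1]) ->
  set_fun (C `\` A) A h -> set_inj (C `\` A) h ->
  exists2 F : T * T -> T, set_fun (C `*` C) A F & set_inj (C `*` C) F.
Proof.
move=> [a0 [a1 [Aa0 Aa1 a01]]] hA hI.
pose e x := if pselect (A x) then f (a0, x) else f (a1, h x).
have eA x : C x -> A (e x).
  by move=> Cx; rewrite /e; case: pselect => Ax; apply: fA; split=> //=; exact: hA.
have eI x y : C x -> C y -> e x = e y -> x = y.
  move=> Cx Cy; rewrite /e; case: pselect => Ax; case: pselect => Ay.
  - by case/pairing_inj.
  - by case/pairing_inj => //; exact: hA.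
  - by case/pairing_inj => //; [exact: hA|move=> /esym].
  - case/pairing_inj => //; [exact: hA|exact: hA|move=> _ /hI].
    by rewrite !inE; apply.
exists (fun u => f (e u.1, e u.2)) => [[x y] [/= Cx Cy]|[x y] [x' y']].
  by apply: fA; split; exact: eA.
rewrite !inE => -[/= Cx Cy] [/= Cx' Cy'] /pairing_inj[||||ex ey]; try exact: eA.
by congr pair; exact: eI.
Qed.

End PairingFunction.

Lemma infinite_nat_inj (T : Type) : infinite_set [set: T] ->
  exists i : nat -> T, injective i.
Proof.
move=> /infiniteP/card_leP[g].
exists (fun n => set_val (g (SigSub (mem_set (I : [set: nat] n))))) => m n.
by move=> /val_inj/(@inj _ _ _ g); rewrite !inE => /(_ I I)/(congr1 val).
Qed.

(** Zorn's lemma on pairs [(A, f)] with [f] an injection of [A * A] into [A], ordered by extension.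
    For a maximal pair, if the complement injects into [A], it is absorbed and all of [T] gets a
    pairing. Otherwise the complement contains a copy of [A], on which [f] could be extended. *)
Lemma infinite_pairing (T : Type) : infinite_set [set: T] ->
  exists f : T * T -> T, injective f.
Proof.
move=> infT.
have [i iI] := infinite_nat_inj infT.
pose P (u : set T * (T * T -> T)) :=
  [/\ set_fun (u.1 `*` u.1) u.1 u.2, set_inj (u.1 `*` u.1) u.2 & range i `<=` u.1].
pose R (u v : set T * (T * T -> T)) :=
  u.1 `<=` v.1 /\ forall x, (u.1 `*` u.1) x -> u.2 x = v.2 x.
have Rtr u v w : R u v -> R v w -> R u w.
  move=> [uv1 uv2] [vw1 vw2]; split; first exact: subset_trans vw1.
  move=> x ux; rewrite uv2 // vw2 //.
  by case: ux => /uv1 ? /uv1.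
have [j jK] : exists j : T -> nat, cancel i j.
  have /choice[j jP] x : exists n, range i x -> i n = x.
    by have [[n _ <-]|] := pselect (range i x); [exists n|exists 0%N].
  by exists j => n; apply: iI; apply: jP; exists n.
(* The starting pair lives on a countable set, where [pickle] on pairs of naturals provides the
   injection. *)
pose u0 := (range i, fun x : T * T => i (pickle (j x.1, j x.2))).
have Pu0 : P u0.
  split=> [x _|[x y] [x' y']|] //=; first by exists (pickle (j x.1, j x.2)).
  rewrite !inE => -[/= [m _ <-] [n _ <-]] [/= [m' _ <-] [n' _ <-]].
  by rewrite !jK => /iI/(pcan_inj pickleK)[-> ->].
have [||F [uF FuF] FP Ftot|[A f] [fA fI iA] Amax] := zorn_preorder Pu0 (R := R).
- by split.
- exact: Rtr.
- pose U := \bigcup_(u in F) u.1.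
  have Uu u : F u -> u.1 `<=` U by move=> Fu x ux; exists u.
  have /choice[g gP] x : exists y, forall u, F u -> (u.1 `*` u.1) x -> u.2 x = y.
    have [[u [Fu ux]]|N] := pselect (exists u, F u /\ (u.1 `*` u.1) x).
      exists (u.2 x) => v Fv vx.
      by have [[_ ->]|[_ ->]] := Ftot _ _ Fu Fv.
    by exists x.1 => u Fu ux; case: N; exists u.
  have UF x : (U `*` U) x -> exists2 u, F u & (u.1 `*` u.1) x.
    move=> [[u Fu ux] [v Fv vx]].
    have [[uv _]|[vu _]] := Ftot _ _ Fu Fv; first by exists v => //; split=> //; exact: uv.
    by exists u => //; split=> //; exact: vu.
  have UF2 x y : (U `*` U) x -> (U `*` U) y ->
      exists u, [/\ F u, (u.1 `*` u.1) x & (u.1 `*` u.1) y].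
    move=> /UF[u Fu [ux1 ux2]] /UF[v Fv [vx1 vx2]].
    have [[uv _]|[vu _]] := Ftot _ _ Fu Fv; [exists v|exists u].
      by split=> //; split; exact: uv.
    by split=> //; split; exact: vu.
  exists (U, g) => [|u Fu]; last first.
    by split=> [|x ux] /=; [exact: Uu|exact: gP].
  split=> [x /UF[u Fu ux]|x y|] /=.
  + by rewrite -(gP _ u) //; apply: (Uu u) => //; have [+ _ _] := FP _ Fu; apply.
  + rewrite !inE => Ux Uy; have [u [Fu ux uy]] := UF2 _ _ Ux Uy.
    rewrite -(gP _ u) // -(gP y u) //.
    by have [_ uI _] := FP _ Fu; apply: uI; rewrite inE.
  + by have [_ _ iu] := FP _ FuF; apply: subset_trans iu (Uu _ FuF).
(* Two distinct tags are needed to absorb the complement; they come from [range i], which every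
   candidate set contains. *)
have a01 : exists a0 a1, [/\ A a0, A a1 & a0 <> a1].
  exists (i 0%N), (i 1%N); split; [by apply: iA; exists 0%N|by apply: iA; exists 1%N|].
  by move/iI.
rewrite /= in fA fI iA.
have [[g gA gI]|[g gA gI]] := set_inj_total (~` A) A.
  have [||F _ FI] := @pairing_absorb _ f A fA fI setT g a01; rewrite ?setTD //.
  by exists F => x y /FI; rewrite !inE; apply.
pose C := A `|` g @` A.
have /choice[h hP] x : exists y, (g @` A) x -> A y /\ g y = x.
  have [[y Ay <-]|] := pselect ((g @` A) x); by [exists y|exists x].
have CA x : (C `\` A) x -> (g @` A) x by move=> [[]].
have [||F FA FI] := @pairing_absorb _ f A fA fI C h a01.
- by move=> x /CA/hP[].
- move=> x y; rewrite !inE => /CA/hP[_ {2}<-] /CA/hP[_ {2}<-] ->//.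
pose f' x := if pselect ((A `*` A) x) then f x else g (F x).
have [||/= CsA _] := Amax (C, f').
- split=> [x Cx|x y|x /iA] /=; last by left.
  + by rewrite /f'; case: pselect => Ax; [left; exact: fA|right; exists (F x) => //; exact: FA].
  + rewrite !inE => Cx Cy; rewrite /f'; case: pselect => Ax; case: pselect => Ay.
    * by move/fI; rewrite !inE; apply.
    * by move=> /= fg; case: (gA (F y)); [exact: FA|rewrite -fg; exact: fA].
    * by move=> /= fg; case: (gA (F x)); [exact: FA|rewrite fg; exact: fA].
    * move/gI; rewrite !inE => /(_ (FA _ Cx) (FA _ Cy))/FI.
      by rewrite !inE; apply.
- by split=> [|x Ax] /=; [exact: subsetUl|rewrite /f'; case: pselect].
- have [a0 [_ [Aa0 _ _]]] := a01; case: (gA a0) => //.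
  by apply: CsA; right; exists a0.
Qed.

Lemma seq_inj_infinite (T : Type) : infinite_set [set: T] ->
  exists f : seq T -> T, injective f.
Proof.
move=> infT; have [p pI] := infinite_pairing infT.
have [i iI] := infinite_nat_inj infT.
pose code := foldr (fun x y => p (x, y)) (i 0%N).
(* The length is stored as well: [i 0] may itself be a value of [p], so [code] alone does not show
   where the list ends. *)
exists (fun s => p (i (size s), code s)) => s t /pI[/iI + /=].
elim: s t => [|x s IHs] [|y t] //= [st] /pI[-> /(IHs _ st)->//].
Qed.

(** * Gauss's lemma *)

Definition divides (R : comPzRingType) (x y : R) := exists z, y = x * z.

Definition irred (R : idomainType) (x : R) :=
  [/\ x != 0, x \isn't a GRing.unit &
      forall a b, x = a * b -> a \is a GRing.unit \/ b \is a GRing.unit].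

Definition factors (R : idomainType) (x : R) :=
  exists u (s : seq R), [/\ u \is a GRing.unit, (forall a, a \in s -> irred a) &
                            x = u * \prod_(a <- s) a].

(** Unique factorization in the form that Gauss's lemma uses: factorizations exist and irreducible
    elements are prime. *)
Definition factorial_ring (R : idomainType) :=
  (forall x : R, x != 0 -> factors x) /\
  (forall p a b : R, irred p -> divides p (a * b) -> divides p a \/ divides p b).

Section Divides.
Variable R : comPzRingType.
Implicit Types x y z : R.

Lemma dividesD x y z : divides x y -> divides x z -> divides x (y + z).
Proof. by move=> [a ->] [b ->]; exists (a + b); rewrite mulrDr. Qed.

Lemma dividesN x y : divides x y -> divides x (- y).
Proof. by move=> [a ->]; exists (- a); rewrite mulrN. Qed.

Lemma dividesMr x y z : divides x y -> divides x (y * z).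
Proof. by move=> [a ->]; exists (a * z); rewrite mulrA. Qed.

Lemma dividesMl x y z : divides x y -> divides x (z * y).
Proof. by rewrite mulrC; exact: dividesMr. Qed.

Lemma divides_sum x (I : Type) (r : seq I) (P : pred I) (F : I -> R) :
  (forall i, P i -> divides x (F i)) -> divides x (\sum_(i <- r | P i) F i).
Proof.
move=> xF; elim/big_rec: _ => [|i y Pi xy]; first by exists 0; rewrite mulr0.
by apply: dividesD => //; exact: xF.
Qed.

End Divides.

Lemma reducible_split (R : idomainType) (x : R) :
  x != 0 -> x \isn't a GRing.unit -> ~ irred x ->
  exists a b, [/\ x = a * b, a \isn't a GRing.unit & b \isn't a GRing.unit].
Proof.
move=> x0 xU xNI; apply: contrapT => Nab; apply: xNI; split=> // a b xab.
have [aU|aU] := boolP (a \is a GRing.unit); first by left.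
have [bU|bU] := boolP (b \is a GRing.unit); first by right.
by case: Nab; exists a, b.
Qed.

Lemma factorsM (S : idomainType) (x y : S) : factors x -> factors y -> factors (x * y).
Proof.
move=> [u [s [uU sI ->]]] [v [t [vU tI ->]]].
exists (u * v), (s ++ t); rewrite unitrM uU vU big_cat; split=> //.
  by move=> c; rewrite mem_cat => /orP[/sI|/tI].
by rewrite mulrACA.
Qed.

Section GaussLemma.
Variable R : idomainType.
Hypothesis Rfact : factorial_ring R.
Implicit Types (c p q : R) (f g h : {poly R}).

Lemma irred_divides_prod p (s : seq R) : irred p -> (forall a, a \in s -> irred a) ->
  divides p (\prod_(a <- s) a) ->
  exists2 q, q \in s & exists2 u, u \is a GRing.unit & q = p * u.
Proof.
move=> pI; have [p0 pU _] := pI.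
elim: s => [_|q s IHs sI].
  by rewrite big_nil => -[z /esym pz1]; case/negP: pU; apply/unitrP; exists z; rewrite mulrC.
rewrite big_cons => /(Rfact.2 _ _ _ pI)[[u qpu]|].
  exists q; rewrite ?mem_head //; exists u => //.
  have [_ _ /(_ _ _ qpu)[pU'|//]] := sI q (mem_head _ _).
  by rewrite pU' in pU.
move=> /IHs[a as_|r rs ru]; first by apply: sI; rewrite inE as_ orbT.
by exists r; rewrite // inE rs orbT.
Qed.

Lemma irred_ndivides_unit p c : irred p -> c \is a GRing.unit -> ~ divides p c.
Proof.
move=> [_ /negP pU _] cU [z cpz]; apply: pU.
by move: cU; rewrite cpz unitrM => /andP[].
Qed.

Lemma divides_polyC p f : divides p%:P f <-> forall i, divides p f`_i.
Proof.
split=> [[g ->] i|pf]; first by exists g`_i; rewrite coefCM.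
have [g gP] := choice pf; exists (\poly_(i < size f) g i).
apply/polyP => i; rewrite coefCM coef_poly.
by case: ltnP => [_|/(nth_default 0)->//]; rewrite ?mulr0.
Qed.

(** If [p] divides neither factor, take the least indices [i] and [j] of coefficients it does not
    divide. In the coefficient of index [i + j] of the product, every term but [f_i * g_j] is
    divisible by [p]. *)
Lemma irred_polyC_prime p f g : irred p -> divides p%:P (f * g) ->
  divides p%:P f \/ divides p%:P g.
Proof.
move=> pI /divides_polyC pfg.
apply: contrapT => /not_orP[/divides_polyC/existsNP Nf /divides_polyC/existsNP Ng].
have minidx h : (exists i, ~ divides p h`_i) ->
    exists i, ~ divides p h`_i /\ forall j, (j < i)%N -> divides p h`_j.
  move=> [i0 Ni0]; have ex : exists i, `[< ~ divides p h`_i >] by exists i0; exact/asboolP.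
  exists (ex_minn ex); case: ex_minnP => i /asboolP Ni imin; split=> // j ji.
  apply: contrapT => Nj; have := imin j (introT (asboolP _) Nj).
  by rewrite leqNgt ji.
have [i [Ni imin]] := minidx _ Nf; have [j [Nj jmin]] := minidx _ Ng.
have iij : (i < (i + j).+1)%N by rewrite ltnS leq_addr.
have := pfg (i + j)%N; rewrite coefM (bigD1 (Ordinal iij)) //= addKn.
set S := \sum_(k < _ | _) _ => pS.
have : divides p S.
  apply: divides_sum => k; rewrite -val_eqE /= neq_ltn => /orP[ki|ik].
    by apply: dividesMr; exact: imin.
  by apply/dividesMl/jmin; rewrite ltn_subLR ?ltn_add2r// -ltnS.
move=> /dividesN /(dividesD pS); rewrite addrK => /(Rfact.2 _ _ _ pI)[]//.
Qed.

(** For nonzero [f], this says without gcds that the content is a unit. *)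
Definition primitive f := forall p, irred p -> ~ divides p%:P f.

(** The irreducible factors of [c] are removed one at a time: each is prime in the polynomial ring
    and does not divide the primitive [f], so it divides [g]. *)
Lemma primitive_cancel f h g c : primitive f -> c != 0 ->
  c%:P * h = f * g -> divides f h.
Proof.
move=> fP /Rfact.1[u [s [uU sI ->]]].
elim: s sI g => [_|p s IHs sI] g.
  rewrite big_nil mulr1 => uh; exists (u^-1%:P * g).
  by rewrite mulrCA -uh mulrA -polyCM mulVr // mul1r.
rewrite big_cons mulrCA polyCM -mulrA => pfg.
have pI := sI p (mem_head _ _); have [p0 _ _] := pI.
have [|/(fP _ pI)//|[g' gE]] := @irred_polyC_prime p f g pI.
  by exists ((u * \prod_(a <- s) a)%:P * h).
apply: (IHs _ g') => [a as_|]; first by apply: sI; rewrite inE as_ orbT.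
by apply: (@mulfI _ p%:P); rewrite ?polyC_eq0 // pfg gE mulrCA.
Qed.

(** Induction on the number of irreducible factors of the leading coefficient: dividing [f] by an
    irreducible constant uses up one of them. *)
Lemma primitive_part f : f != 0 ->
  exists c g, [/\ c != 0, primitive g & f = c%:P * g].
Proof.
move=> f0; have : factors (lead_coef f) by apply: Rfact.1; rewrite lead_coef_eq0.
move=> [u [s [uU sI]]]; have [n] := ubnP (size s).
elim: n u s f f0 uU sI => // n IHn u s f f0 uU sI /ltnSE-sn fE.
have [fP|/existsNP[p /not_implyP[pI /contrapT[g fpg]]]] := pselect (primitive f).
  by exists 1, f; rewrite oner_neq0 mul1r.
have [p0 pU _] := pI.
have g0 : g != 0 by apply: contraNneq f0 => g0; rewrite fpg g0 mulr0.
have lE : p * lead_coef g = u * \prod_(a <- s) a.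
  by rewrite -fE fpg lead_coefM lead_coefC.
have [|q qs [v vU qE]] := @irred_divides_prod p s pI sI.
  have [|/(irred_ndivides_unit pI uU)//|//] := Rfact.2 p u (\prod_(a <- s) a) pI.
  by exists (lead_coef g).
have [||||c [h [c0 hP gE]]] := IHn (u * v) (rem q s) g g0.
- by rewrite unitrM uU.
- by move=> a /mem_rem/sI.
- rewrite size_rem //; apply: leq_trans sn; rewrite prednK //.
  by case: (s) qs.
- apply: (mulfI p0); rewrite lE (perm_big _ (perm_to_rem qs)) big_cons qE /=.
  by rewrite !mulrA; congr (_ * _); rewrite mulrAC [p * u]mulrC mulrAC.
- exists (p * c), h; split=> //; first by rewrite mulf_neq0.
  by rewrite fpg gE polyCM mulrA.
Qed.

Lemma primitive_const c : primitive c%:P -> c != 0 -> c \is a GRing.unit.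
Proof.
move=> cP /Rfact.1[u [[|p s] [uU sI cE]]]; first by rewrite cE big_nil mulr1.
case: (cP p); first by apply: sI; rewrite mem_head.
exists (u * \prod_(a <- s) a)%:P; rewrite cE big_cons -polyCM; congr _%:P.
by rewrite mulrCA.
Qed.

Lemma polyCU c : (c%:P \is a GRing.unit) = (c \is a GRing.unit).
Proof.
by rewrite poly_unitE size_polyC coefC /=; case: (eqVneq c 0) => // ->; rewrite unitr0.
Qed.

Lemma irred_polyC p : irred p <-> irred p%:P.
Proof.
split=> [[p0 pU pI]|[p0 pU pI]].
  split; rewrite ?polyC_eq0 ?polyCU // => f g pfg.
  have : size (f * g) == 1%N by rewrite -pfg size_polyC p0.
  rewrite size_mul_eq1 => /andP[/size_poly1P[a a0 fa] /size_poly1P[b b0 gb]].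
  rewrite fa gb !polyCU; apply: pI.
  by apply/polyC_inj; rewrite pfg fa gb polyCM.
rewrite polyC_eq0 polyCU in p0 pU.
by split=> // a b pab; rewrite -!polyCU; apply: pI; rewrite pab polyCM.
Qed.

(** Induction on the degree. Factors of a primitive polynomial are primitive, and a primitive
    nonunit is not constant, so both factors of a proper splitting have smaller degree. *)
Lemma primitive_factors f : primitive f -> f != 0 -> factors f.
Proof.
have [n] := ubnP (size f); elim: n f => // n IHn f /ltnSE-fn fP f0.
have [/size1_polyC fE|f1] := leqP (size f) 1.
  exists f, [::]; rewrite big_nil mulr1; split=> //.
  rewrite fE polyC_eq0 in fP f0; rewrite fE polyCU; exact: primitive_const.
have [fI|fNI] := pselect (irred f).
  exists 1, [:: f]; rewrite unitr1 big_seq1 mul1r; split=> // a.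
  by rewrite inE => /eqP->.
have fNU : f \isn't a GRing.unit.
  by rewrite poly_unitE; move: f1; case: (size f) => [|[]].
have := reducible_split f0 fNU fNI => -[a [b [fab aU bU]]].
have [a0 b0] : a != 0 /\ b != 0 by apply/andP; rewrite -negb_or -mulf_eq0 -fab.
have aP : primitive a by move=> p pI pa; apply: (fP p pI); rewrite fab; exact: dividesMr.
have bP : primitive b by move=> p pI pb; apply: (fP p pI); rewrite fab; exact: dividesMl.
have size_gt1 h : primitive h -> h != 0 -> h \isn't a GRing.unit -> (1 < size h)%N.
  move=> hP h0; apply: contraR; rewrite -leqNgt => /size1_polyC hE.
  rewrite hE polyC_eq0 in hP h0 *; rewrite polyCU.
  exact: primitive_const.
have a1 := size_gt1 _ aP a0 aU; have b1 := size_gt1 _ bP b0 bU.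
have sE : (size a + size b = (size f).+1)%N.
  by rewrite fab size_mul // prednK // addn_gt0 (ltn_trans _ a1).
have [|u [s [uU sI aE]]] := IHn a _ aP a0.
  by apply: leq_trans fn; rewrite -ltnS -sE -[X in (X < _)%N]addn1 ltn_add2l.
have [|v [t [vU tI bE]]] := IHn b _ bP b0.
  by apply: leq_trans fn; rewrite -ltnS -sE -[X in (X < _)%N]add1n ltn_add2r.
exists (u * v), (s ++ t); rewrite unitrM uU vU big_cat; split=> //.
  by move=> c; rewrite mem_cat => /orP[/sI|/tI].
by rewrite fab aE bE /= mulrACA.
Qed.

Lemma irred_primitive f : irred f -> (1 < size f)%N -> primitive f.
Proof.
move=> [f0 fU fI] f1 p pI [g fpg]; have [_ pU _] := (irred_polyC p).1 pI.
have [pU'|gU] := fI _ _ fpg; first by rewrite pU' in pU.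
have p0 : p != 0 by have [] := pI.
move: f1; rewrite fpg size_Cmul // ltnNge.
by move: gU; rewrite poly_unitE => /andP[/eqP->].
Qed.

(* A nonzero combination of [f] and [g] of least degree divides both up to
   constants (pseudo-division), so its primitive part divides both. *)
Lemma irred_poly_prime f g h : irred f -> divides f (g * h) ->
  divides f g \/ divides f h.
Proof.
move=> fI [w ghE]; have [f0 _ fIab] := fI.
have [/size1_polyC fE|f1] := leqP (size f) 1.
  rewrite fE; apply: irred_polyC_prime; first by apply/irred_polyC; rewrite -fE.
  by exists w; rewrite -fE.
have fP := irred_primitive fI f1.
have [fg|Nfg] := pselect (divides f g); [by left|right].
pose comb r := exists a b : {poly R}, r = a * f + b * g.
have combM r a b (c : {poly R}) : comb r -> comb (a * f + b * g + c * r).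
  by move=> [x [y ->]]; exists (a + c * x), (b + c * y);
     rewrite !mulrDl mulrDr !mulrA addrACA.
have ex : exists n, `[< exists r, [/\ comb r, r != 0 & size r = n] >].
  exists (size f); apply/asboolP; exists f; split=> //.
  by exists 1, 0; rewrite mul1r mul0r addr0.
case: (ex_minnP ex) => n /asboolP[r [rc r0 rn]] rmin {ex}.
have rdiv m : comb m -> exists2 c, c != 0 & exists q : {poly R}, c%:P * m = q * r.
  move=> mc; have := Pdiv.Idomain.divp_eq m r; set c := _ ^+ _ => cE.
  exists c; first by rewrite expf_neq0 // lead_coef_eq0.
  exists (m %/ r)%R; rewrite mul_polyC cE; apply/eqP.
  rewrite -subr_eq0 addrC addKr; apply: contraTT (ltn_modpN0 m r0) => N0.
  rewrite -leqNgt rn; apply: rmin; apply/asboolP; exists (m %% r)%R.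
  have [x [y mE]] := mc; split=> //.
  have -> : (m %% r)%R = c%:P * x * f + c%:P * y * g + (- (m %/ r)) * r.
    by rewrite mulNr -!mulrA -mulrDr -mE mul_polyC cE addrC addKr.
  exact: combM.
have [c0 [r' [c00 rP rE]]] := primitive_part r0.
have r'div m : comb m -> divides r' m.
  move=> /rdiv[c cn0 [q cm]]; apply: (@primitive_cancel _ _ (c0%:P * q) c) => //.
  by rewrite cm rE mulrA mulrC [q * _]mulrC.
have [|a fE] := r'div f; first by exists 1, 0; rewrite mul1r mul0r addr0.
have [|b gE] := r'div g; first by exists 0, 1; rewrite mul1r mul0r add0r.
(* If [a] is a unit, then [f] divides [g], which is excluded. So [r'] is a unit and the constant
   [c0] is a combination of [f] and [g]; hence [f] divides [c0 * h], and primitivity of [f] removes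
   [c0]. *)
have [rU|aU] := fIab _ _ fE; last first.
  case: Nfg; exists (a^-1 * b); rewrite fE gE.
  by rewrite -mulrA mulVKr.
have [x [y rc']] := rc.
apply: (@primitive_cancel _ h (r'^-1 * (x * h + y * w)) c0) => //.
have -> : c0%:P = r'^-1 * r by rewrite rE mulrCA mulVr // mulr1.
rewrite -mulrA [f * _]mulrCA; congr (_ * _).
by rewrite rc' mulrDl mulrDr -[y * g * h]mulrA ghE mulrCA; congr (_ + _); rewrite -mulrA mulrCA.
Qed.

Lemma factorial_poly : factorial_ring {poly R}.
Proof.
split=> [f f0|f g h]; last exact: irred_poly_prime.
have [c [g [c0 gP fE]]] := primitive_part f0.
rewrite fE; apply: factorsM; last first.
  by apply: primitive_factors => //; apply: contraNneq f0 => g0; rewrite fE g0 mulr0.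
have [u [s [uU sI ->]]] := Rfact.1 _ c0.
exists u%:P, (map polyC s); split.
- by rewrite polyCU.
- by move=> a /mapP[b /sI bI ->]; exact/irred_polyC.
- by rewrite big_map polyCM rmorph_prod.
Qed.

End GaussLemma.

(** * Subrings as integral domains *)

Section SubDomain.
Variables (K : fieldType) (D : subringClosed K).

(** The subring as a type of its own, so that Gauss's lemma, stated for an [idomainType], applies to
    it. *)
Record subdomain := SubDomain { subdomain_val :> K; _ : subdomain_val \in D }.

HB.instance Definition _ := [isSub for subdomain_val].
HB.instance Definition _ := [Choice of subdomain by <:].
HB.instance Definition _ := [SubChoice_isSubComNzRing of subdomain by <:].

(** Invertibility is meant inside the subring rather than in [K]; the inverse is picked by choice
    when it exists. *)
Let unit_sd : pred subdomain := fun x => `[< exists y, y * x = 1 >].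
Let inv_sd x := if pselect (exists y : subdomain, y * x = 1) is left e then projT1 (cid e) else x.

Fact subdomain_mulVx : {in unit_sd, left_inverse 1 inv_sd *%R}.
Proof.
move=> x /asboolP xU; rewrite /inv_sd; case: pselect => // e.
by case: cid.
Qed.

Fact subdomain_unitP x y : y * x = 1 -> unit_sd x.
Proof. by move=> yx; apply/asboolP; exists y. Qed.

Fact subdomain_invr_out : {in [predC unit_sd], inv_sd =1 id}.
Proof.
by move=> x /negP xU; rewrite /inv_sd; case: pselect => // e; case: xU; exact/asboolP.
Qed.

HB.instance Definition _ := GRing.ComNzRing_hasMulInverse.Build subdomain
  subdomain_mulVx subdomain_unitP subdomain_invr_out.

Fact subdomain_integral (x y : subdomain) : x * y = 0 -> (x == 0) || (y == 0).
Proof.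
by move=> /(congr1 val)/eqP; rewrite rmorphM rmorph0 mulf_eq0 -!(inj_eq val_inj) rmorph0.
Qed.

HB.instance Definition _ := GRing.ComUnitRing_isIntegral.Build subdomain subdomain_integral.

End SubDomain.

(** * Factorial subrings and inert extensions *)

Definition divides_in (K : fieldType) (D : {pred K}) (x y : K) :=
  exists2 z, z \in D & y = x * z.

Definition factorial_in (K : fieldType) (D : {pred K}) :=
  [/\ GRing.subring_closed D,
      (forall x, x \in D -> x != 0 -> exists u (s : seq K),
         [/\ unit_in D u, (forall a, a \in s -> irreducible_in D a) &
             x = u * \prod_(a <- s) a]) &
      (forall p a b, irreducible_in D p -> a \in D -> b \in D ->
         divides_in D p (a * b) -> divides_in D p a \/ divides_in D p b)].

Section SubringClosed.
Variables (K : fieldType) (D : {pred K}).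
Hypothesis Dring : GRing.subring_closed D.

Lemma subring1 : 1 \in D. Proof. by case: Dring. Qed.

Lemma subringB : {in D &, forall x y, x - y \in D}. Proof. by case: Dring. Qed.

Lemma subringM : {in D &, forall x y, x * y \in D}. Proof. by case: Dring. Qed.

Lemma subring0 : 0 \in D.
Proof. by rewrite -(subrr 1) subringB ?subring1. Qed.

Lemma subringN : {in D, forall x, - x \in D}.
Proof. by move=> x Dx; rewrite -sub0r subringB ?subring0. Qed.

Lemma subringD : {in D &, forall x y, x + y \in D}.
Proof. by move=> x y Dx Dy; rewrite -[y]opprK subringB ?subringN. Qed.

Lemma subringX n : {in D, forall x, x ^+ n \in D}.
Proof. by move=> x Dx; elim: n => [|n IHn]; rewrite ?subring1 // exprS subringM. Qed.

Lemma subring_prod (s : seq K) : (forall a, a \in s -> a \in D) -> \prod_(a <- s) a \in D.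
Proof.
move=> sD; rewrite big_seq; elim/big_rec: _ => [|a x /sD Da Dx]; first exact: subring1.
exact: subringM.
Qed.

Lemma subring_sum (I : Type) (r : seq I) (P : pred I) (F : I -> K) :
  (forall i, P i -> F i \in D) -> \sum_(i <- r | P i) F i \in D.
Proof.
by move=> FD; elim/big_rec: _ => [|i x /FD Dx Dy]; [exact: subring0|exact: subringD].
Qed.

Lemma subring_intr n : n%:~R \in D.
Proof.
have natD m : m%:R \in D.
  by elim: m => [|m IHm]; rewrite ?subring0 // mulrSr subringD ?subring1.
by case: n => m; rewrite ?NegzE ?rmorphN ?subringN //= ; exact: natD.
Qed.

Lemma subring_polyOverP (p : {poly K}) : p \is a polyOver D <-> forall i, p`_i \in D.
Proof.
pose S : subringClosed K := HB.pack (D : K -> bool) (GRing.isSubringClosed.Build K D Dring).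
by split=> /(@polyOverP _ S p).
Qed.

Lemma unit_in1 : unit_in D 1.
Proof. by split; [exact: subring1|exists 1; rewrite ?mulr1 //; exact: subring1]. Qed.

Lemma unit_inM x y : unit_in D x -> unit_in D y -> unit_in D (x * y).
Proof.
move=> [Dx [x' Dx' xx']] [Dy [y' Dy' yy']]; split; first exact: subringM.
by exists (x' * y'); rewrite ?subringM // mulrACA xx' yy' mulr1.
Qed.

Lemma unit_inMl x y : x \in D -> y \in D -> unit_in D (x * y) -> unit_in D x.
Proof.
move=> Dx Dy [_ [z Dz xyz]]; split=> //; exists (y * z); first exact: subringM.
by rewrite mulrA.
Qed.

Lemma unit_inV x : unit_in D x -> unit_in D x^-1.
Proof.
move=> [Dx [y Dy xy]]; have x0 : x != 0.
  by apply: contra_eq_neq xy => ->; rewrite mul0r eq_sym oner_eq0.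
have -> : x^-1 = y by apply: (mulfI x0); rewrite divff.
by split=> //; exists x; rewrite // mulrC.
Qed.

Lemma unit_in_neq0 x : unit_in D x -> x != 0.
Proof.
move=> [_ [y _ xy]]; apply: contra_eq_neq xy => ->.
by rewrite mul0r eq_sym oner_eq0.
Qed.

Lemma irreducible_associate x u : irreducible_in D x -> unit_in D u ->
  irreducible_in D (u * x).
Proof.
move=> [Dx x0 xU xI] uU; have [Du _] := uU; have u0 := unit_in_neq0 uU.
have u'U := unit_inV uU; have [Du' _] := u'U.
split=> [|||a b Da Db uxab]; first exact: subringM.
- exact: mulf_neq0.
- by move=> uxU; apply: xU; rewrite mulrC in uxU; exact: unit_inMl uxU.
- have [|/(unit_inM uU)|bU] := xI (u^-1 * a) b (subringM Du' Da) Db.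
  + by rewrite -mulrA -uxab mulKf.
  + by rewrite mulVKf //; left.
  + by right.
Qed.

End SubringClosed.

Section Range.
Variables (K : fieldType) (R : idomainType) (phi : {rmorphism R -> K}) (D : {pred K}).
Hypotheses (phiI : injective phi) (DE : forall x, x \in D <-> exists r, x = phi r).

Lemma range_subring_closed : GRing.subring_closed D.
Proof.
split=> [|x y /DE[a ->] /DE[b ->]|x y /DE[a ->] /DE[b ->]]; apply/DE.
- by exists 1; rewrite rmorph1.
- by exists (a - b); rewrite rmorphB.
- by exists (a * b); rewrite rmorphM.
Qed.

Let phiD r : phi r \in D. Proof. by apply/DE; exists r. Qed.

Lemma range_unit r : unit_in D (phi r) <-> r \is a GRing.unit.
Proof.
split=> [[_ [y /DE[s ->]]]|rU].
  rewrite -rmorphM -(rmorph1 phi) => /phiI rs.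
  by apply/unitrP; exists s; rewrite [s * r]mulrC.
by split=> //; exists (phi r^-1); rewrite // -rmorphM divrr // rmorph1.
Qed.

Lemma range_irreducible r : irreducible_in D (phi r) <-> irred r.
Proof.
have p0 : (phi r != 0) = (r != 0) by rewrite -(rmorph0 phi) (inj_eq phiI).
split=> [[_ r0 rU rI]|[r0 rU rI]].
  split=> [||a b rab]; first by rewrite -p0.
    by apply/negP => /range_unit.
  have [//||/range_unit|/range_unit] := rI (phi a) (phi b) (phiD a); try exact: phiD.
  - by rewrite rab rmorphM.
  - by left.
  - by right.
split=> //; first by rewrite p0.
- by move=> /range_unit; apply/negP.
- move=> a b /DE[a' ->] /DE[b' ->]; rewrite -rmorphM => /phiI/rI.
  by case=> /range_unit; [left|right].
Qed.

Lemma range_divides a b : divides_in D (phi a) (phi b) <-> divides a b.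
Proof.
split=> [[_ /DE[c ->]]|[c ->]]; first by rewrite -rmorphM => /phiI->; exists c.
by exists (phi c); rewrite ?rmorphM.
Qed.

(** Transports factoriality along an isomorphism of [R] onto [D]. It serves for the integers, for
    polynomial rings and for [subdomain]. *)
Lemma range_factorial : factorial_ring R <-> factorial_in D.
Proof.
split=> [[Rat Rpr]|[_ Dat Dpr]]; split.
- exact: range_subring_closed.
- move=> _ /DE[r ->]; rewrite -{1}(rmorph0 phi) (inj_eq phiI) => /Rat[u [s [uU sI ->]]].
  exists (phi u), (map phi s); split; first exact/range_unit.
    by move=> _ /mapP[a /sI aI ->]; exact/range_irreducible.
  by rewrite rmorphM rmorph_prod big_map.
- move=> p a b pI /DE[a' ->] /DE[b' ->]; have [Dp _ _ _] := pI.
  move: pI; case/DE: Dp => p' -> /range_irreducible pI.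
  by rewrite -rmorphM !range_divides; exact: Rpr.
- move=> r r0; have [||u [s [uU sI rE]]] := Dat (phi r) => //.
    by rewrite -(rmorph0 phi) (inj_eq phiI).
  have [s' sE] : exists s', s = map phi s'.
    elim: s sI {rE} => [|a s IHs] sI; first by exists [::].
    have [/DE[a' ->] _ _ _] := sI a (mem_head _ _).
    have [|s' ->] := IHs; last by exists (a' :: s').
    by move=> b bs; apply: sI; rewrite inE bs orbT.
  have [/DE[u' uE] _] := uU; exists u', s'; split.
  + by apply/range_unit; rewrite -uE.
  + by move=> a as'; apply/range_irreducible/sI; rewrite sE map_f.
  + by apply: phiI; rewrite rE uE sE rmorphM rmorph_prod big_map.
- move=> p a b pI /range_divides; rewrite rmorphM => /Dpr[]; try exact: phiD.
  + exact/range_irreducible.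
  + by left; exact/range_divides.
  + by right; exact/range_divides.
Qed.

End Range.

Section FactorialSubring.
Variables (K : fieldType) (D : {pred K}).
Hypothesis Dfact : factorial_in D.
Let Dring : GRing.subring_closed D. Proof. by case: Dfact. Qed.

Lemma irreducible_divides_unit p u : irreducible_in D p -> unit_in D u -> ~ divides_in D p u.
Proof.
by move=> [Dp _ pU _] uU [z Dz uE]; apply: pU; apply: (unit_inMl Dring Dp Dz); rewrite -uE.
Qed.

Lemma irreducible_divides_prod p (s : seq K) : irreducible_in D p ->
  (forall a, a \in s -> irreducible_in D a) -> divides_in D p (\prod_(a <- s) a) ->
  exists2 q, q \in s & associates_in D p q.
Proof.
move=> pI; have [_ _ Dpr] := Dfact; have [Dp _ pU _] := pI.
elim: s => [_|q s IHs sI].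
  by rewrite big_nil => /(irreducible_divides_unit pI)[]; exact: unit_in1.
have sI' a : a \in s -> irreducible_in D a by move=> as_; apply: sI; rewrite inE as_ orbT.
have [Dq _ _ qI] := sI q (mem_head _ _).
rewrite big_cons => /Dpr[//|//||[z Dz qpz]|/(IHs sI')[r rs pr]].
- by apply: subring_prod => // a /sI'[].
- exists q; first exact: mem_head.
  by case: (qI _ _ Dp Dz qpz) => // zU; exists z; rewrite // mulrC.
- by exists r; rewrite // inE rs orbT.
Qed.

(** The unit [u] makes the induction go through: cancelling [a] against its associate [b] leaves a
    unit behind, which is collected there. *)
Lemma prod_irreducible_unique (s t : seq K) u : unit_in D u ->
  (forall a, a \in s -> irreducible_in D a) ->
  (forall a, a \in t -> irreducible_in D a) ->
  \prod_(a <- s) a = u * \prod_(a <- t) a ->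
  exists t' : seq K, [/\ perm_eq t t', size s = size t' &
    forall i, (i < size s)%N -> associates_in D s`_i t'`_i].
Proof.
elim: s t u => [|a s IHs] t u uU sI tI.
  rewrite big_nil; case: t tI => [_ _|b t tI]; first by exists [::]; split.
  rewrite big_cons => /esym ubt1; have bI := tI b (mem_head _ _).
  case: (irreducible_divides_unit bI (unit_in1 Dring)).
  exists (u * \prod_(a <- t) a); last by rewrite mulrCA.
  apply: subringM => //; first by case: uU.
  by apply: subring_prod => // c ct; case: (tI c); rewrite ?inE ?ct ?orbT.
have aI := sI a (mem_head _ _); have [Da a0 _ _] := aI.
have tD : \prod_(a <- t) a \in D by apply: subring_prod => // c /tI[].
have Du : u \in D by case: uU.
rewrite big_cons => ast.
have : divides_in D a (u * \prod_(a <- t) a).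
  exists (\prod_(a <- s) a) => //; apply: subring_prod => // c cs.
  by case: (sI c); rewrite // inE cs orbT.
have [_ _ Dpr] := Dfact.
move=> /Dpr[//|//|//|/(irreducible_divides_unit aI uU)//|].
move=> /(irreducible_divides_prod aI tI)[b bt [v vU bE]].
have tb := perm_to_rem bt.
have [||||t' [tt' st' ss]] := IHs (rem b t) (u * v).
- exact: unit_inM.
- by move=> c cs; apply: sI; rewrite inE cs orbT.
- by move=> c /mem_rem/tI.
- apply: (mulfI a0); rewrite ast (perm_big _ tb) big_cons /=.
  set P := \prod_(c <- rem b t) c; rewrite bE [v * a]mulrC -[a * v * P]mulrA mulrCA.
  by rewrite [u * (v * P)]mulrA.
exists (b :: t'); split.
- by apply: perm_trans tb _; rewrite perm_cons.
- by rewrite /= st'.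
- by case=> [_|i /ss//]; exists v.
Qed.

Lemma factorial_is_UFD : is_UFD D.
Proof.
have [_ Dat _] := Dfact; split=> //.
- move=> x Dx x0 xU; have [u [[|a s] [uU sI xE]]] := Dat x Dx x0.
    by case: xU; rewrite xE big_nil mulr1.
  exists (u * a :: s) => [b|]; last by rewrite xE !big_cons mulrA.
  rewrite inE => /orP[/eqP->|bs]; last by apply: sI; rewrite inE bs orbT.
  by apply: irreducible_associate => //; apply: sI; exact: mem_head.
- move=> s t sI tI st; apply: (prod_irreducible_unique (unit_in1 Dring)) => //.
  by rewrite mul1r.
Qed.

End FactorialSubring.

(** Also called factorially closed. By commutativity the conclusion holds for [b] as well. *)
Definition inert (K : fieldType) (D E : {pred K}) :=
  {subset D <= E} /\
  forall a b, a \in E -> b \in E -> a * b \in D -> a * b != 0 -> a \in D.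

Section Inert.
Variables (K : fieldType) (D E : {pred K}).
Hypotheses (Dring : GRing.subring_closed D) (Ering : GRing.subring_closed E).
Hypothesis DE : inert D E.

Lemma inert_unit x : unit_in E x <-> unit_in D x.
Proof.
have [sDE DEi] := DE; split=> [[Ex [y Ey xy]]|[Dx [y Dy xy]]].
  split; first by apply: (DEi x y); rewrite // xy ?subring1 ?oner_eq0.
  exists y => //; apply: (DEi y x) => //; rewrite mulrC xy ?oner_eq0 //.
  exact: subring1.
by split; [exact: sDE|exists y => //; exact: sDE].
Qed.

Lemma inert_irreducible x : x \in D -> irreducible_in D x <-> irreducible_in E x.
Proof.
have [sDE DEi] := DE; move=> Dx; split=> -[_ x0 xU xI]; split=> //.
- exact: sDE.
- by move=> /inert_unit.
- move=> a b Ea Eb xab; have [|||/inert_unit aU|/inert_unit bU] := xI a b => //.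
  + by apply: (DEi a b); rewrite -?xab.
  + by apply: (DEi b a); rewrite // mulrC -xab.
  + by left.
  + by right.
- by move=> /inert_unit.
- move=> a b Da Db xab; have [|||/inert_unit aU|/inert_unit bU] := xI a b => //; try exact: sDE.
  + by left.
  + by right.
Qed.

End Inert.

Lemma inert_trans (K : fieldType) (D E F : {pred K}) : inert D E -> inert E F -> inert D F.
Proof.
move=> [sDE DEi] [sEF EFi]; split=> [x /sDE/sEF//|a b Fa Fb abD ab0].
have abE := sDE _ abD; apply: (DEi a b) => //; first exact: (EFi a b).
by apply: (EFi b a); rewrite // mulrC.
Qed.

(** * Unions of chains of factorial subrings *)

Section Chain.
Variables (K : fieldType) (C : set {pred K}).
Hypotheses (C0 : C !=set0) (Cfact : forall D, C D -> factorial_in D).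
Hypothesis Ctot : total_on C (@inert K).

Definition chain_union : {pred K} := fun x => `[< exists2 D, C D & x \in D >].

Lemma chain_unionP x : reflect (exists2 D, C D & x \in D) (x \in chain_union).
Proof. exact: asboolP. Qed.

(** Reduces questions about finitely many elements of the union to a single member of the chain;
    totality allows moving up once for each element. *)
Lemma chain_common (D : {pred K}) (s : seq K) : C D -> all (mem chain_union) s ->
  exists E, [/\ C E, inert D E & all (mem E) s].
Proof.
move=> CD; elim: s => [|a s IHs] /=; first by exists D; split=> //; split.
move=> /andP[/chain_unionP[F CF Fa] /IHs[E [CE DE sE]]].
case: (Ctot CE CF) => EF; last first.
  by exists E; split=> //; rewrite sE andbT; case: EF => + _; apply.
exists F; split=> //; first exact: inert_trans EF.
by rewrite Fa; apply/allP => b /(allP sE) Eb; case: EF => + _; apply.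
Qed.

Lemma chain_inert D : C D -> inert D chain_union.
Proof.
move=> CD; split=> [x Dx|a b Ua Ub]; first by apply/chain_unionP; exists D.
have [|E [_ [_ DEi] /and3P[Ea Eb _]]] := @chain_common D [:: a; b] CD.
  by rewrite /= Ua Ub.
exact: DEi.
Qed.

(** A factorization found in one member stays valid, since units and irreducibles are unchanged.
    Primality is checked in a member that contains the quotient [c] too, so that the divisibility
    already holds there. *)
Lemma chain_factorial : factorial_in chain_union.
Proof.
have [D0 CD0] := C0.
have Uring : GRing.subring_closed chain_union.
  have common x y : x \in chain_union -> y \in chain_union ->
      exists E, [/\ C E, x \in E & y \in E].
    move=> Ux Uy; have [|E [CE _ /and3P[Ex Ey _]]] := @chain_common _ [:: x; y] CD0.
      by rewrite /= Ux Uy.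
    by exists E.
  split=> [|x y /common/[apply] -[E [CE Ex Ey]]|x y /common/[apply] -[E [CE Ex Ey]]].
  - by apply/chain_unionP; exists D0; rewrite // subring1 //; case: (Cfact CD0).
  - by apply/chain_unionP; exists E; rewrite // subringB //; case: (Cfact CE).
  - by apply/chain_unionP; exists E; rewrite // subringM //; case: (Cfact CE).
split=> // [x /chain_unionP[D CD Dx] x0|p a b pI Ua Ub [c Uc abE]].
  have DU := chain_inert CD; have [Dring Dat _] := Cfact CD.
  have [u [s [uU sI xE]]] := Dat x Dx x0; exists u, s; split=> //.
    exact/(inert_unit Dring DU).
  by move=> a as_; apply/(inert_irreducible Dring DU); [case: (sI a as_)|exact: sI].
have [Up _ _ _] := pI.
have [|E [CE _ /and5P[Ep Ea Eb Ec _]]] := @chain_common _ [:: p; a; b; c] CD0.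
  by rewrite /= Up Ua Ub Uc.
have EU := chain_inert CE; have [Ering _ Epr] := Cfact CE.
have [sEU _] := EU.
have /Epr/(_ Ea Eb)[] : irreducible_in E p by apply/(inert_irreducible Ering EU).
- by exists c.
- by move=> [z Ez ->]; left; exists z => //; exact: sEU.
- by move=> [z Ez ->]; right; exists z => //; exact: sEU.
Qed.

End Chain.

(** As [t] is transcendental, evaluation at [t] identifies the polynomial ring with [D[t]], which is
    factorial by Gauss's lemma. The extension is inert because factors of a nonzero constant
    polynomial are constant. *)
Lemma range_adjoin_transcendental (K : fieldType) (R : idomainType)
    (phi : {rmorphism R -> K}) (D : {pred K}) (t : K) :
  injective phi -> (forall x, x \in D <-> exists r, x = phi r) -> factorial_ring R ->
  (forall p, p \is a polyOver D -> root p t -> p = 0) ->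
  exists E : {pred K}, [/\ factorial_in E, inert D E, t \in E & t \notin D].
Proof.
move=> phiI DE Rfact tD; have Dring := range_subring_closed DE.
pose psi : {rmorphism {poly R} -> K} := horner_eval t \o map_poly phi.
have psiE p : psi p = (map_poly phi p).[t] by [].
have psiC r : psi r%:P = phi r by rewrite psiE map_polyC hornerC.
have psiI : injective psi.
  apply: raddf_inj => p pt; have {}pt : (map_poly phi p).[t] = 0 := pt.
  apply: (map_inj_poly phiI (rmorph0 phi)); rewrite rmorph0; apply: tD; last exact/eqP.
  by apply/(subring_polyOverP Dring) => i; rewrite coef_map /=; apply/DE; exists p`_i.
pose E : {pred K} := fun x => `[< exists p, x = psi p >].
have EP x : x \in E <-> exists p, x = psi p by exact: (iff_sym (rwP (asboolP _))).
exists E; split.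
- by apply/(range_factorial psiI EP); exact: factorial_poly.
- split=> [x /DE[r ->]|a b /EP[f ->] /EP[g ->]]; first by apply/EP; exists r%:P.
  rewrite -rmorphM => /DE[r]; rewrite -psiC => /psiI fgr; rewrite fgr psiC => r0.
  have : size (f * g) == 1%N.
    rewrite fgr size_polyC; have -> // : r != 0.
    by apply: contraNneq r0 => ->; rewrite rmorph0.
  by rewrite size_mul_eq1 => /andP[/size_poly1P[c _ ->] _]; apply/DE; exists c.
- by apply/EP; exists (polyX R); rewrite psiE map_polyX hornerX.
- apply/negP => Dt; have /tD : 'X - t%:P \is a polyOver D.
    apply/(subring_polyOverP Dring) => i; rewrite coefB coefX coefC.
    by apply: (subringB Dring); case: (i == _); rewrite //= ?(subring0 Dring) ?(subring1 Dring).
  by rewrite root_XsubC eqxx => /(_ isT)/eqP; rewrite polyXsubC_eq0.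
Qed.

Lemma adjoin_transcendental (K : fieldType) (D : {pred K}) (t : K) :
  factorial_in D -> (forall p, p \is a polyOver D -> root p t -> p = 0) ->
  exists E : {pred K}, [/\ factorial_in E, inert D E, t \in E & t \notin D].
Proof.
move=> Dfact; have [Dring _ _] := Dfact.
pose S : subringClosed K := HB.pack (D : K -> bool) (GRing.isSubringClosed.Build K D Dring).
pose phi : {rmorphism subdomain S -> K} := val.
have DE x : x \in D <-> exists r, x = phi r.
  by split=> [Dx|[r ->]]; [exists (SubDomain (Dx : x \in S))|exact: valP].
apply: (range_adjoin_transcendental (val_inj : injective phi) DE).
exact/(range_factorial (val_inj : injective phi) DE).
Qed.

Lemma factorial_algebraic_extension (K : fieldType) (D0 : {pred K}) : factorial_in D0 ->
  exists D : {pred K}, [/\ factorial_in D, inert D0 D & algebraic_over_subring D].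
Proof.
move=> D0fact.
have [||||D [Dfact D0D] Dmax] := @zorn_preorder _
    (fun D : {pred K} => factorial_in D /\ inert D0 D) (@inert K) D0.
- by split=> //; split.
- by move=> D; split.
- exact: inert_trans.
- move=> C [D CD] CP Ctot; exists (chain_union C).
    split; last first.
      by have [_ /inert_trans] := CP _ CD; apply; exact: chain_inert.
    by apply: chain_factorial => [|E /CP[]//|//]; exists D.
  by move=> E CE; exact: chain_inert.
exists D; split=> // t; apply: contrapT => Nt.
have [|E [Efact DE tE]] := @adjoin_transcendental _ D t Dfact.
  move=> p pD pt; apply: contrapT => /eqP p0; apply: Nt.
  by exists p.
case/negP; have [] := Dmax E; last by move=> + _; apply.
- by split=> //; exact: inert_trans DE.
- exact: DE.
Qed.

(** * The prime subring *)

Lemma divides_dvdz (m n : int) : divides m n <-> (m %| n)%Z.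
Proof.
split=> [[q ->]|/dvdzP[q ->]]; first exact: dvdz_mulr.
by exists q; rewrite mulrC.
Qed.

Lemma factorial_int : factorial_ring int.
Proof.
split=> [n|p a b].
  have [m] := ubnP `|n|%N; elim: m n => // m IHm n /ltnSE-nm n0.
  have [nU|nU] := boolP (n \is a GRing.unit).
    by exists n, [::]; rewrite big_nil mulr1.
  have [nI|nNI] := pselect (irred n).
    exists 1, [:: n]; rewrite unitr1 big_seq1 mul1r; split=> // a.
    by rewrite inE => /eqP->.
  have := reducible_split n0 nU nNI => -[a [b [nab aU bU]]].
  have [a0 b0] : a != 0 /\ b != 0 by apply/andP; rewrite -negb_or -mulf_eq0 -nab.
  have abs_gt1 (c : int) : c != 0 -> c \isn't a GRing.unit -> (1 < `|c|)%N.
    rewrite -absz_gt0 => c0 cU; rewrite ltn_neqAle c0 andbT eq_sym.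
    by apply: contra cU; case: c {c0} => [[|[|?]]|[|?]].
  have a1 := abs_gt1 _ a0 aU; have b1 := abs_gt1 _ b0 bU.
  rewrite nab; apply: factorsM; apply: IHm => //; apply: leq_trans nm.
    by rewrite nab abszM ltn_Pmulr // (ltn_trans _ a1).
  by rewrite nab abszM ltn_Pmull // (ltn_trans _ b1).
move=> [p0 pU pI] /divides_dvdz pab.
(* Irreducibility of [p = c * gcd(p, a)] leaves two cases: [p] is associated to the gcd and divides
   [a], or [p] is coprime to [a] and divides [b]. *)
have /dvdzP[c pE] := dvdz_gcdl p a.
case: (pI _ _ pE) => [cU|gU].
  left; apply/divides_dvdz; apply: dvdz_trans (dvdz_gcdr p a).
  by apply/dvdzP; exists c^-1; rewrite [X in _ * X]pE mulKr.
right; apply/divides_dvdz; rewrite -(@Gauss_dvdzr _ a) //.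
by move: gU; rewrite unfold_in /= /coprimez => /orP[->//|/eqP g1].
Qed.

(** A copy of the integers in characteristic 0 and of the field with [p] elements in characteristic
    [p]. *)
Definition prime_subring (K : fieldType) : {pred K} :=
  fun x => `[< exists n : int, x = n%:~R >].
Arguments prime_subring : clear implicits.

Section PrimeSubring.
Variable K : fieldType.

Lemma prime_subringP (x : K) : x \in prime_subring K <-> exists n : int, x = n%:~R.
Proof. exact: (iff_sym (rwP (asboolP _))). Qed.

Lemma prime_subring_closed : GRing.subring_closed (prime_subring K).
Proof.
split=> [|x y /prime_subringP[m ->] /prime_subringP[n ->]|
          x y /prime_subringP[m ->] /prime_subringP[n ->]]; apply/prime_subringP.
- by exists 1.
- by exists (m - n); rewrite rmorphB.
- by exists (m * n); rewrite rmorphM.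
Qed.

Section Pchar0.
Hypothesis K0 : [pchar K] =i pred0.

Lemma pchar0_intr_inj : injective (intmul 1 : int -> K).
Proof.
have nat0 := (pcharf0P K).1 K0.
apply: raddf_inj => -[] n; rewrite -[_ = 0]/(_%:~R = 0 :> K) => /eqP.
  by rewrite /= nat0 => /eqP->.
by rewrite NegzE mulrNz oppr_eq0 nat0.
Qed.

Lemma pchar0_prime_subring_unit (n : int) :
  unit_in (prime_subring K) n%:~R <-> n \is a GRing.unit.
Proof. exact: (range_unit pchar0_intr_inj prime_subringP). Qed.

End Pchar0.

Section PcharP.
Variable p : nat.
Hypothesis pK : p \in [pchar K].

Let p_prime : prime p. Proof. exact: pcharf_prime pK. Qed.

Lemma pchar_prime_subringP x : x \in prime_subring K -> exists2 k, (k < p)%N & x = k%:R.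
Proof.
have p_gt0 : 0 < p%:Z by rewrite ltz_nat prime_gt0.
have p0 : p%:Z != 0 by rewrite gt_eqF.
move=> /prime_subringP[n ->].
have : (n %% p)%Z < p%:Z := ltz_pmod n p_gt0.
have : 0 <= (n %% p)%Z by exact: modz_ge0.
case E : (n %% p)%Z => [k|//] _ kp; exists k; first by [].
rewrite {1}(divz_eq n p) E rmorphD rmorphM /= -pmulrn.
by rewrite (pcharf0 pK) mulr0 add0r.
Qed.

Lemma pchar_prime_subring_unit x : x \in prime_subring K -> x != 0 ->
  unit_in (prime_subring K) x.
Proof.
move=> Dx; have [k kp ->] := pchar_prime_subringP Dx => k0.
(* Fermat's little theorem [k ^ p = k], read off the Frobenius map, gives the inverse
   [k ^ (p - 2)]. *)
have := pFrobenius_aut_nat pK k; rewrite pFrobenius_autE.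
case: p (prime_gt1 p_prime) => [|[|q]] // _; rewrite exprS => kq.
split; first by apply/prime_subringP; exists k.
exists (k%:R ^+ q); first by apply/prime_subringP; exists (k ^ q)%N; rewrite -natrX.
by apply: (mulfI k0); rewrite -exprS kq mulr1.
Qed.

Lemma pchar_algebraic_absolutely :
  algebraic_over_subring (prime_subring K) -> absolutely_algebraic K.
Proof.
move=> Kalg; exists p => // x; have [f [fD f0 fx]] := Kalg x.
have {fD} /choice[k kP] i : exists k, (k < p)%N /\ f`_i = k%:R.
  have [|k kp fk] := @pchar_prime_subringP f`_i; last by exists k.
  exact: (subring_polyOverP prime_subring_closed f).1.
(* Representatives below [p] are unchanged by the passage through ['F_p], so [g] maps back to
   [f]. *)
pose g : {poly 'F_p} := \poly_(i < size f) (k i)%:R.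
have gf : map_poly (fun c : 'F_p => (c : nat)%:R : K) g = f.
  apply/polyP => i; rewrite coef_map_id0 // coef_poly; case: ltnP => [_|/(nth_default 0)->//].
  by rewrite val_Fp_nat // modn_small; case: (kP i).
exists g; last by rewrite gf.
by apply: contraNneq f0 => g0; rewrite -gf g0 map_poly0.
Qed.

End PcharP.

Lemma unit_in_prime_subring_finite :
  exists us : seq K, forall x, unit_in (prime_subring K) x -> x \in us.
Proof.
have [[p pK]|K0] := pselect (exists p, p \in [pchar K]).
  exists [seq k%:R | k <- iota 0 p] => x [/(pchar_prime_subringP pK)[k kp ->] _].
  by apply/mapP; exists k; rewrite // mem_iota.
exists [:: 1; -1] => x xU; have [/prime_subringP[n xn] _] := xU.
move: xU; rewrite xn => /pchar0_prime_subring_unit; rewrite unfold_in /= => nU.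
have /nU/orP[] : [pchar K] =i pred0.
  by move=> p; apply/negP => pK; apply: K0; exists p.
all: by move=> /eqP->; rewrite ?mulrN1z !inE eqxx ?orbT.
Qed.

Lemma prime_subring_factorial : factorial_in (prime_subring K).
Proof.
have [[p pK]|K0] := pselect (exists p, p \in [pchar K]).
  (* In positive characteristic every nonzero element is a unit, so no irreducible exists. *)
  split=> [|x Dx x0|q a b [Dq q0 []]]; first exact: prime_subring_closed.
    by exists x, [::]; rewrite big_nil mulr1; split=> //; exact: (pchar_prime_subring_unit pK).
  exact: (pchar_prime_subring_unit pK).
have {}K0 : [pchar K] =i pred0 by move=> p; apply/negP => pK; apply: K0; exists p.
apply/(range_factorial (pchar0_intr_inj K0) prime_subringP).
exact: factorial_int.
Qed.

(** In characteristic [p], if all nonzero elements of [D] were units, inertness would put them in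
    the prime field and [K] would be absolutely algebraic. In characteristic 0, the integer 2 is a
    nonunit of the prime subring, hence of [D]. *)
Lemma inert_exists_nonunit (D : {pred K}) : ~ absolutely_algebraic K ->
  GRing.subring_closed D -> inert (prime_subring K) D -> algebraic_over_subring D ->
  exists d, [/\ d \in D, d != 0 & ~ unit_in D d].
Proof.
move=> Kna Dring PD Dalg; have iU := inert_unit prime_subring_closed PD.
have [[p pK]|K0] := pselect (exists p, p \in [pchar K]).
  apply: contrapT => Nd; apply: Kna; apply: (pchar_algebraic_absolutely pK) => x.
  have [f [/(subring_polyOverP Dring) fD f0 fx]] := Dalg x; exists f; split=> //.
  apply/(subring_polyOverP prime_subring_closed) => i.
  have [->|fi0] := eqVneq f`_i 0; first exact: subring0 prime_subring_closed.
  have [/(iU _)[]//|NU] := pselect (unit_in D f`_i).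
  by case: Nd; exists f`_i.
have {}K0 : [pchar K] =i pred0 by move=> p; apply/negP => pK; apply: K0; exists p.
exists (2%:~R); split; first exact: subring_intr.
  by rewrite ((pcharf0P K).1 K0).
by move=> /(iU _)/(pchar0_prime_subring_unit K0).
Qed.

End PrimeSubring.

(** * Maximal subrings *)

Lemma map_polyMXaddC (R R' : nzRingType) (phi : {rmorphism R -> R'}) (p : {poly R}) c :
  map_poly phi (p * 'X + c%:P) = map_poly phi p * 'X + (phi c)%:P.
Proof. by rewrite rmorphD rmorphM /= map_polyX map_polyC. Qed.

Lemma map_polyCM (R R' : nzRingType) (phi : {rmorphism R -> R'}) (p : {poly R}) c :
  map_poly phi (c%:P * p) = (phi c)%:P * map_poly phi p.
Proof. by rewrite rmorphM /= map_polyC. Qed.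

(** Multiplying [x = s(1/x)] by [x ^ (m - 1)], with [m] the size of [s], gives a monic equation of
    degree [m] with the coefficients of [s] reversed. *)
Lemma integral_of_horner_inv (R : comNzRingType) (K : fieldType) (phi : {rmorphism R -> K})
    (s : {poly R}) (x : K) :
  x != 0 -> x = (map_poly phi s).[x^-1] -> integralOver phi x.
Proof.
move=> x0 xE; set m := size s.
have m0 : (0 < m)%N.
  rewrite size_poly_gt0; apply: contraNneq x0 => s0.
  by rewrite xE s0 rmorph0 horner0.
exists ('X^m - \poly_(i < m) s`_(m.-1 - i)).
  rewrite monicE lead_coefDl ?lead_coefXn // size_polyN size_polyXn ltnS.
  exact: size_poly.
rewrite /root rmorphB /= map_polyXn hornerD hornerN hornerXn subr_eq0; apply/eqP.
rewrite -{1}(prednK m0) exprSr {2}xE.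
rewrite (@horner_coef_wide _ m); last exact: size_poly.
rewrite mulr_sumr (@horner_coef_wide _ m); last first.
  by apply: leq_trans (size_poly _ _) (size_poly _ _).
rewrite [RHS](reindex_inj rev_ord_inj) /=; apply: eq_bigr => i _.
rewrite !coef_map coef_poly /=.
have im : (i <= m.-1)%N by rewrite -ltnS prednK.
have -> : (m - i.+1 = m.-1 - i)%N by rewrite -subn1 -subnDA add1n.
rewrite subKn // (leq_ltn_trans (leq_subr _ _)) ?ltn_predL //.
rewrite mulrCA; congr (_ * _).
by rewrite -[in LHS](subnK im) exprD -mulrA exprVn divff ?mulr1 // expf_neq0.
Qed.

Lemma subring_horner (K : fieldType) (T : {pred K}) (p : {poly K}) x :
  GRing.subring_closed T -> p \is a polyOver T -> x \in T -> p.[x] \in T.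
Proof.
move=> Tring /(subring_polyOverP Tring) pT Tx; rewrite horner_coef.
by apply: subring_sum => // i _; apply: subringM => //; exact: subringX.
Qed.

(** After removing factors ['X], the equation reads [y * f(y) = - c] with [c] nonzero in [D], so the
    inverse of [y] is [- f(y) / c]. *)
Lemma subring_inv_algebraic (K : fieldType) (D T : {pred K}) (y : K) (f : {poly K}) :
  GRing.subring_closed D -> GRing.subring_closed T -> {subset D <= T} ->
  (forall d, d \in D -> d != 0 -> d^-1 \in T) -> y \in T -> y != 0 ->
  f \is a polyOver D -> f != 0 -> root f y -> y^-1 \in T.
Proof.
move=> Dring Tring DT DV Ty y0; elim/poly_ind: f => [|f c IHf]; first by rewrite eqxx.
move=> /(subring_polyOverP Dring) fD.
have fD' : f \is a polyOver D.
  apply/(subring_polyOverP Dring) => i; have := fD i.+1.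
  by rewrite coefD coefMX coefC addr0.
have cD : c \in D by have := fD 0%N; rewrite coefD coefMX coefC add0r.
have [->|c0] := eqVneq c 0.
  rewrite addr0 mulf_eq0 polyX_eq0 orbF => f0.
  by rewrite rootM rootX (negPf y0) orbF; exact: IHf.
move=> _; rewrite /root hornerMXaddC addr_eq0 => /eqP fy.
have -> : y^-1 = - f.[y] * c^-1.
  apply: (mulfI y0); rewrite divff // mulrA mulrN [y * _]mulrC fy opprK divff //.
apply: subringM => //; last exact: DV.
apply: subringN => //; apply: subring_horner => //.
by apply/(subring_polyOverP Tring) => i; apply: DT; exact: (subring_polyOverP Dring f).1.
Qed.

(** Horner's scheme downwards: subtracting the constant term and multiplying by [x^-1] lowers the
    degree while the value stays in [T]. At the end the quotient is the constant 1 and [x] itself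
    remains. *)
Lemma subring_inv_integral (K : fieldType) (T : {pred K}) (x : K) (f : {poly K}) :
  GRing.subring_closed T -> x^-1 \in T -> f \is monic -> (1 < size f)%N ->
  f \is a polyOver T -> f.[x] \in T -> x \in T.
Proof.
move=> Tring TxV; elim/poly_ind: f => [|f c IHf]; first by rewrite size_poly0.
have [->|f0] := eqVneq f 0.
  by move=> _; rewrite mul0r add0r ltnNge size_polyC leq_b1.
rewrite monicE => fmon _ /(subring_polyOverP Tring) fT; rewrite hornerMXaddC => fxT.
have {}fmon : f \is monic.
  move: fmon; rewrite lead_coefDl ?lead_coefMX ?monicE // size_mulX // size_polyC.
  by rewrite ltnS (leq_trans (leq_b1 _)) // size_poly_gt0.
have Tf : f \is a polyOver T.
  apply/(subring_polyOverP Tring) => i; have := fT i.+1.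
  by rewrite coefD coefMX coefC addr0.
have Tc : c \in T by have := fT 0%N; rewrite coefD coefMX coefC add0r.
have {}fxT : f.[x] * x \in T by rewrite -(addrK c (_ * _)); exact: subringB.
have [f1|f1] := leqP (size f) 1; last first.
  have [x0|x0] := eqVneq x 0; first by rewrite x0; exact: subring0.
  by apply: IHf => //; rewrite -(mulfK x0 f.[x]); exact: subringM.
move: fxT fmon; rewrite (size1_polyC f1) hornerC monicE lead_coefC => + /eqP f01.
by rewrite f01 mul1r.
Qed.

Lemma subring_maximal_avoiding (K : fieldType) (L : {pred K}) (c : K) :
  GRing.subring_closed L -> c \notin L ->
  exists S : {pred K}, [/\ GRing.subring_closed S, {subset L <= S}, c \notin S &
    forall T : {pred K}, GRing.subring_closed T -> {subset S <= T} -> c \notin T ->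
      {subset T <= S}].
Proof.
move=> Lring Lc.
pose P (S : {pred K}) := [/\ GRing.subring_closed S, {subset L <= S} & c \notin S].
have [||S T U ST TU x /ST/TU//|C [S0 CS0] CP Ctot|S [Sring LS Sc] Smax] :=
    @zorn_preorder _ P (fun S T => {subset S <= T}) L.
- by split.
- by move=> S x.
- pose U : {pred K} := fun x => `[< exists2 S : {pred K}, C S & x \in S >].
  have UP x : x \in U <-> exists2 S : {pred K}, C S & x \in S.
    exact: (iff_sym (rwP (asboolP _))).
  have common x y : x \in U -> y \in U -> exists S : {pred K}, [/\ C S, x \in S & y \in S].
    move=> /UP[S CS Sx] /UP[T CT Ty].
    by have [ST|TS] := Ctot _ _ CS CT; [exists T; split=> //; exact: ST|
                                        exists S; split=> //; exact: TS].
  exists U; last by move=> S CS x Sx; apply/UP; exists S.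
  split.
  + split=> [|x y /common/[apply] -[S [CS Sx Sy]]|x y /common/[apply] -[S [CS Sx Sy]]];
      apply/UP.
    * by exists S0 => //; apply: subring1; case: (CP _ CS0).
    * by exists S => //; apply: subringB => //; case: (CP _ CS).
    * by exists S => //; apply: subringM => //; case: (CP _ CS).
  + by move=> x Lx; apply/UP; exists S0 => //; case: (CP _ CS0) => _ + _; apply.
  + by apply/negP => /UP[S CS]; apply/negP; case: (CP _ CS).
- by exists S; split=> // T Tring ST Tc; apply: Smax => //; split=> // x /LS/ST.
Qed.

(** * Subrings maximal among those avoiding the inverse of [q] *)

Section AvoidingInverse.
Variables (K : fieldType) (S : {pred K}) (q : K).
Hypotheses (Sring : GRing.subring_closed S) (Sq : q \in S) (q0 : q != 0) (SqV : q^-1 \notin S).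
Hypothesis Smax : forall T : {pred K}, GRing.subring_closed T -> {subset S <= T} ->
  q^-1 \notin T -> {subset T <= S}.

Let S' : subringClosed K := HB.pack (S : K -> bool) (GRing.isSubringClosed.Build K S Sring).
Let phi : {rmorphism subdomain S' -> K} := val.

Let phiS (r : subdomain S') : phi r \in S. Proof. exact: (valP r). Qed.

(** The ring [S[x]] is strictly larger than [S], so by maximality it contains [q^-1]. *)
Lemma avoiding_inv_adjoin x : x \notin S ->
  exists p : {poly subdomain S'}, q^-1 = (map_poly phi p).[x].
Proof.
move=> Sx; apply: contrapT => Np.
pose psi : {rmorphism {poly subdomain S'} -> K} := horner_eval x \o map_poly phi.
pose T : {pred K} := fun y => `[< exists p, y = psi p >].
have TP y : y \in T <-> exists p, y = psi p by exact: (iff_sym (rwP (asboolP _))).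
have psiE p : psi p = (map_poly phi p).[x] by [].
case/negP: Sx; apply: (@Smax T); first exact: range_subring_closed TP.
- move=> y Sy; apply/TP; exists (SubDomain (Sy : y \in S'))%:P.
  by rewrite psiE map_polyC hornerC.
- by apply/negP => /TP[p pE]; apply: Np; exists p.
- by apply/TP; exists 'X; rewrite psiE map_polyX hornerX.
Qed.

(** An integral [x] outside [S] would make [q^-1], an element of [S[x]], integral over [S]. Since
    [q] lies in [S], the integral equation would then put [q^-1] in [S]. *)
Lemma avoiding_inv_integral x : integralOver phi x -> x \in S.
Proof.
move=> xint; apply/negPn/negP => /avoiding_inv_adjoin[p pE].
have [f fmon froot] : integralOver phi q^-1.
  rewrite pE; apply: integral_horner => //; apply/integral_poly => i.
  by rewrite coef_map; exact: integral_id.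
have f1 : (1 < size f)%N.
  rewrite ltnNge; apply/negP => /size1_polyC fE; move: fmon froot.
  rewrite fE monicE lead_coefC => /eqP->.
  by rewrite map_polyC rootC; apply/negP; exact: oner_neq0.
case/negP: SqV; apply: (@subring_inv_integral _ _ _ (map_poly phi f)) => //.
- by rewrite invrK.
- exact: monic_map.
- by rewrite (size_map_inj_poly val_inj).
- by apply/(subring_polyOverP Sring) => i; rewrite coef_map; exact: phiS.
- by rewrite (eqP froot); exact: subring0.
Qed.

(* The localization of [S] at [1 - q S] still avoids [q^-1], so it is [S] itself. *)
Lemma avoiding_inv_unit b : b \in S -> (1 - q * b)^-1 \in S.
Proof.
move=> Sb; set e := 1 - q * b.
have Se : e \in S by apply: subringB => //; [exact: subring1|exact: subringM].
have e0 : e != 0.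
  apply: contra SqV; rewrite subr_eq0 => /eqP qb.
  by have -> : q^-1 = b by apply: (mulfI q0); rewrite divff.
(* Powers of [e] stay congruent to 1 modulo [q], so [q^-1 * e ^+ k] differs from [q^-1] by an
   element of [S]. *)
have eX k : exists2 c, c \in S & e ^+ k = 1 - q * c.
  elim: k => [|k [c Sc IHk]]; first by exists 0; rewrite ?mulr0 ?subr0 ?subring0.
  exists (c + b * e ^+ k).
    by apply: subringD => //; apply: subringM => //; exact: subringX.
  by rewrite exprS {1}/e mulrBl mul1r {1}IHk mulrDr opprD addrA mulrA.
pose T : {pred K} := fun y => `[< exists k, y * e ^+ k \in S >].
have TP y : y \in T <-> exists k, y * e ^+ k \in S by exact: (iff_sym (rwP (asboolP _))).
apply: (@Smax T).
- split=> [|x y /TP[k xk] /TP[l yl]|x y /TP[k xk] /TP[l yl]]; apply/TP.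
  + by exists 0%N; rewrite mulr1; exact: subring1.
  + exists (k + l)%N; rewrite mulrBl {1}exprD addnC exprD !mulrA.
    by apply: subringB => //; apply: subringM => //; apply: subringX.
  + by exists (k + l)%N; rewrite exprD mulrACA; exact: subringM.
- by move=> x Sx; apply/TP; exists 0%N; rewrite mulr1.
- apply/negP => /TP[k]; have [c Sc ->] := eX k.
  rewrite mulrBr mulr1 mulKf // => qc; case/negP: SqV.
  by rewrite -(subrK c q^-1); exact: subringD.
- by apply/TP; exists 1%N; rewrite expr1 mulVf //; exact: subring1.
Qed.

(** If [x^-1] is not in [S], then [q^-1 = b + y * x^-1] with [b] in [S] and [y] in [S[x^-1]], that
    is [(1 - q * b) * x = q * y]. As [1 - q * b] is a unit of [S], [x] is a polynomial in [x^-1]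
    over [S], hence integral over [S]. *)
Lemma avoiding_inv_valuation x : x \in S \/ x^-1 \in S.
Proof.
have [Sx|Sx] := boolP (x \in S); [by left|right; apply/negPn/negP => SxV; case/negP: Sx].
have x0 : x != 0 by apply: contraNneq SxV => ->; rewrite invr0 subring0.
have [p] := avoiding_inv_adjoin SxV; elim/poly_ind: p => [|p c _].
  by rewrite rmorph0 horner0 => /eqP; rewrite invr_eq0 (negPf q0).
rewrite map_polyMXaddC hornerMXaddC => qE.
set y := (map_poly phi p).[x^-1] in qE; set b := phi c in qE.
pose w : subdomain S' := SubDomain (avoiding_inv_unit (phiS c) : _ \in S').
pose q' : subdomain S' := SubDomain (Sq : q \in S').
apply: avoiding_inv_integral.
apply: (@integral_of_horner_inv _ _ phi ((w * q')%:P * p)) => //.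
have e0 : 1 - q * b != 0.
  apply: contra SqV; rewrite subr_eq0 => /eqP qb.
  have -> : q^-1 = b by apply: (mulfI q0); rewrite divff.
  exact: phiS.
rewrite map_polyCM hornerM hornerC -/y.
have -> : phi (w * q') = (1 - q * b)^-1 * q by [].
apply: (mulfI e0); rewrite !mulrA divff // mul1r mulrBl mul1r.
have : q * q^-1 * x = q * (y * x^-1 + b) * x by rewrite qE.
by rewrite divff // mul1r mulrDr mulrDl mulrA mulfVK // => {1}->; rewrite addrK.
Qed.

(** An overring [T] containing [q^-1] inverts every nonzero element of [D]. For [z] outside [S], the
    inverse [z^-1] is in [S] and algebraic over [D], so [z] is in [T], and [T] is all of [K]. *)
Lemma avoiding_inv_maximal (D : {pred K}) : GRing.subring_closed D -> {subset D <= S} ->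
  algebraic_over_subring D ->
  (forall (T : {pred K}) d, GRing.subring_closed T -> {subset S <= T} -> q^-1 \in T ->
     d \in D -> d != 0 -> d^-1 \in T) ->
  maximal_subring S.
Proof.
move=> Dring DS Dalg DV; split=> [//||T Tring [z Tz] ST]; first by exists q^-1.
have [TqV|TqV] := boolP (q^-1 \in T); last exact: Smax.
case/negP: Tz; have [/ST//|/ST TzV] := avoiding_inv_valuation z.
have [z0|z0] := eqVneq z 0; first by rewrite z0 subring0.
have [f [fD f0 fz]] := Dalg z^-1; rewrite -[z]invrK.
apply: (subring_inv_algebraic Dring Tring _ _ TzV _ fD f0 fz); last by rewrite invr_eq0.
- by move=> x /DS/ST.
- by move=> d; exact: DV.
Qed.

End AvoidingInverse.

(** * Localization at an irreducible element *)

Section FactorialLocalization.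
Variables (K : fieldType) (D : {pred K}) (q : K).
Hypotheses (Dfact : factorial_in D) (Dalg : algebraic_over_subring D).
Hypothesis qI : irreducible_in D q.

Let Dring : GRing.subring_closed D. Proof. by case: Dfact. Qed.
Let Dq : q \in D. Proof. by case: qI. Qed.

Definition localization : {pred K} := fun x =>
  `[< exists a b, [/\ a \in D, b \in D, ~ divides_in D q b & x * b = a] >].

Lemma localizationP x : x \in localization <->
  exists a b, [/\ a \in D, b \in D, ~ divides_in D q b & x * b = a].
Proof. exact: (iff_sym (rwP (asboolP _))). Qed.

Lemma localization_closed : GRing.subring_closed localization.
Proof.
have [_ _ Dpr] := Dfact.
have qM b d : b \in D -> d \in D -> ~ divides_in D q b -> ~ divides_in D q d ->
  ~ divides_in D q (b * d) by move=> Db Dd qb qd /(Dpr _ _ _ qI Db Dd)[].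
split=> [|x y /localizationP[a [b [Da Db qb xE]]] /localizationP[c [d [Dc Dd qd yE]]]
         |x y /localizationP[a [b [Da Db qb xE]]] /localizationP[c [d [Dc Dd qd yE]]]];
  apply/localizationP.
- exists 1, 1; rewrite mulr1; split=> //; try exact: subring1.
  exact: (irreducible_divides_unit Dfact qI (unit_in1 Dring)).
- exists (a * d - c * b), (b * d); split; try exact: subringM; try exact: qM.
    by apply: subringB => //; exact: subringM.
  by rewrite mulrBl mulrA xE mulrCA yE [b * c]mulrC.
- exists (a * c), (b * d); split; try exact: subringM; try exact: qM.
  by rewrite mulrACA xE yE.
Qed.

Lemma sub_localization : {subset D <= localization}.
Proof.
move=> x Dx; apply/localizationP; exists x, 1; rewrite mulr1; split=> //; first exact: subring1.
exact: (irreducible_divides_unit Dfact qI (unit_in1 Dring)).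
Qed.

Lemma localization_inv a : a \in D -> ~ divides_in D q a -> a^-1 \in localization.
Proof.
move=> Da qa; apply/localizationP; exists 1, a; split=> //; first exact: subring1.
by rewrite mulVf //; apply: contra_notN qa => /eqP->; exists 0; rewrite ?mulr0 ?subring0.
Qed.

Lemma localization_irreducible_inv : q^-1 \notin localization.
Proof.
have [_ q0 _ _] := qI.
apply/negP => /localizationP[a [b [Da Db qb abE]]]; apply: qb; exists a => //.
by rewrite -abE mulVKf.
Qed.

Lemma irreducible_divides_irreducible r : irreducible_in D r -> divides_in D q r ->
  associates_in D q r.
Proof.
move=> [_ _ _ rI] [z Dz rE]; have [_ _ qU _] := qI.
by case: (rI _ _ Dq Dz rE) => // zU; exists z; rewrite // mulrC.
Qed.

(** Factor [d] in [D]: irreducible factors not divisible by [q] are invertible in the localization,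
    and the others are associates of [q]. *)
Lemma localization_inv_ring (T : {pred K}) d : GRing.subring_closed T ->
  {subset localization <= T} -> q^-1 \in T -> d \in D -> d != 0 -> d^-1 \in T.
Proof.
move=> Tring LT TqV Dd d0; have [_ Dat _] := Dfact.
have [u [s [uU sI ->]]] := Dat d Dd d0.
have DT x : x \in D -> x \in T by move=> /sub_localization/LT.
have TV x : unit_in D x -> x^-1 \in T.
  by move=> /unit_inV[/DT].
rewrite invfM; apply: subringM => //; first exact: TV.
rewrite -prodfV; elim: s sI => [|a s IHs] sI; first by rewrite big_nil subring1.
rewrite big_cons; apply: subringM => //; last first.
  by apply: IHs => b bs; apply: sI; rewrite inE bs orbT.
have aI := sI a (mem_head _ _); have [Da _ _ _] := aI.
have [qa|qa] := pselect (divides_in D q a); last exact/LT/localization_inv.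
have [v vU ->] := irreducible_divides_irreducible aI qa.
by rewrite invfM; apply: subringM => //; exact: TV.
Qed.

Lemma exists_maximal_subring_at : exists S : {pred K},
  [/\ maximal_subring S, {subset D <= S}, q^-1 \notin S &
      forall r, irreducible_in D r -> ~ associates_in D q r -> r^-1 \in S].
Proof.
have [_ q0 _ _] := qI.
have [S [Sring LS SqV Smax]] :=
  subring_maximal_avoiding localization_closed localization_irreducible_inv.
exists S; split=> //.
- apply: (avoiding_inv_maximal Sring _ q0 SqV Smax Dring) => //.
  + by apply: LS; exact: sub_localization.
  + by move=> x /sub_localization/LS.
  + by move=> T d Tring ST; apply: localization_inv_ring => // x /LS/ST.
- by move=> x /sub_localization/LS.
- move=> r rI qr; apply/LS/localization_inv; first by case: rI.
  by move=> /(irreducible_divides_irreducible rI).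
Qed.

End FactorialLocalization.

(** * Irreducible elements *)

Section IrreducibleRepresentatives.
Variables (K : fieldType) (D : {pred K}).
Hypothesis Dring : GRing.subring_closed D.

Lemma associates_refl x : associates_in D x x.
Proof. by exists 1; rewrite ?mul1r //; exact: unit_in1. Qed.

Lemma associates_sym x y : associates_in D x y -> associates_in D y x.
Proof.
move=> [u uU ->]; exists u^-1; first exact: unit_inV.
by rewrite mulKf //; exact: unit_in_neq0 uU.
Qed.

Lemma associates_trans x y z :
  associates_in D x y -> associates_in D y z -> associates_in D x z.
Proof.
by move=> [u uU ->] [v vU ->]; exists (v * u); rewrite ?mulrA //; exact: unit_inM.
Qed.

(** [choose] depends only on the extension of its predicate and not on the witness, so associated
    elements get the same representative. *)
Definition associate_repr x : K := choose (fun y => `[< associates_in D x y >]) x.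

Lemma associate_reprP x : associates_in D x (associate_repr x).
Proof.
by apply/asboolP/(chooseP (P := fun y => `[< associates_in D x y >]));
   apply/asboolP; exact: associates_refl.
Qed.

Lemma associate_repr_eq x y : associates_in D x y -> associate_repr x = associate_repr y.
Proof.
move=> xy; rewrite /associate_repr.
rewrite (@choose_id _ (fun y => `[< associates_in D x y >]) x y); first last.
- exact/asboolP.
- by apply/asboolP; exact: associates_refl.
apply: eq_choose => z; apply/asboolP/asboolP; last exact: associates_trans.
by apply: associates_trans; exact: associates_sym.
Qed.

Definition irreducible_reprs : set K :=
  [set x | irreducible_in D x /\ associate_repr x = x].

Lemma irreducible_reprs_uniq x y : irreducible_reprs x -> irreducible_reprs y ->
  associates_in D x y -> x = y.
Proof. by move=> [_ xE] [_ yE] xy; rewrite -xE -yE; exact: associate_repr_eq. Qed.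

Lemma irreducible_reprs_associate x : irreducible_in D x ->
  exists2 y, irreducible_reprs y & associates_in D x y.
Proof.
move=> xI; exists (associate_repr x); last exact: associate_reprP.
split; last by rewrite -(associate_repr_eq (associate_reprP x)).
by have [u uU ->] := associate_reprP x; exact: irreducible_associate.
Qed.

Lemma irreducible_reprs_is_Irr : is_Irr D irreducible_reprs.
Proof.
split=> [x []//|x /irreducible_reprs_associate[y yI xy]].
exists y; split=> // z [[_ zE] xz]; rewrite -zE -(associate_repr_eq xz).
by rewrite (associate_repr_eq xy); case: yI.
Qed.

End IrreducibleRepresentatives.

(** * Counting the irreducible elements *)

Section FactorialCardinality.
Variables (K : fieldType) (D : {pred K}).
Hypotheses (Dfact : factorial_in D) (Dalg : algebraic_over_subring D).
Variables (us : seq K) (d : K).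
Hypothesis D_units : forall x, unit_in D x -> x \in us.
Hypotheses (Dd : d \in D) (d0 : d != 0) (dU : ~ unit_in D d).

Let Dring : GRing.subring_closed D. Proof. by case: Dfact. Qed.

Lemma nonunit_irreducible_divisor x : x \in D -> x != 0 -> ~ unit_in D x ->
  exists2 q, irreducible_in D q & divides_in D q x.
Proof.
have [_ Dat _] := Dfact; move=> Dx x0 xU.
have [u [[|q s] [uU sI xE]]] := Dat x Dx x0.
  by case: xU; rewrite xE big_nil mulr1.
exists q; first by apply: sI; exact: mem_head.
exists (u * \prod_(a <- s) a); last by rewrite xE big_cons mulrCA.
apply: subringM => //; first by case: uU.
by apply: subring_prod => // a as_; case: (sI a); rewrite // inE as_ orbT.
Qed.

(* Euclid: the numbers [1 + P ^+ k.+1], where [P] is the product of finitely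
   many irreducibles, are all units when there is no other irreducible; but
   they are pairwise distinct. *)
Lemma infinite_irreducible_reprs : infinite_set (irreducible_reprs D).
Proof.
move=> /finite_seqP[s sE].
have sP x : x \in s <-> irreducible_reprs D x by rewrite sE.
pose P := \prod_(a <- s) a.
have sD a : a \in s -> a \in D by move=> /sP[[]].
have DP : P \in D by exact: subring_prod.
have P0 : P != 0.
  rewrite /P big_seq; elim/big_rec: _ => [|a x /sP[[_ a0 _ _] _] x0]; first exact: oner_neq0.
  exact: mulf_neq0.
have Pdiv q : irreducible_in D q -> divides_in D q P.
  move=> /(irreducible_reprs_associate Dring)[r /sP rs [u uU rE]].
  have [Du _] := uU; exists (u * \prod_(a <- rem r s) a).
    by apply: subringM => //; apply: subring_prod => // a /mem_rem/sD.
  by rewrite /P (perm_big _ (perm_to_rem rs)) big_cons rE /= mulrA [q * u]mulrC -rE.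
(* The nonunit [d] provides an irreducible divisor, which also divides [P]. *)
have PU : ~ unit_in D P.
  have [q qI _] := nonunit_irreducible_divisor Dd d0 dU.
  by move=> /(irreducible_divides_unit Dfact qI); apply; exact: Pdiv.
have XU k : ~ unit_in D (P ^+ k.+1).
  by rewrite exprS => /(unit_inMl Dring DP (subringX Dring k DP)).
(* As the exponent is positive, every irreducible divides [P ^+ k.+1], so an irreducible divisor of
   the sum would divide 1. *)
have EU k : unit_in D (1 + P ^+ k.+1).
  have DX : P ^+ k.+1 \in D by exact: subringX.
  apply: contrapT => NU.
  have [||q qI [z Dz qz]] := nonunit_irreducible_divisor _ _ NU.
  - by apply: subringD => //; exact: subring1.
  - rewrite addrC addr_eq0; apply/eqP => PN1; apply: (XU k); rewrite PN1.
    split; first by apply: subringN => //; exact: subring1.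
    by exists (-1); rewrite ?mulrNN ?mulr1 //; apply: subringN => //; exact: subring1.
  - apply: (irreducible_divides_unit Dfact qI (unit_in1 Dring)).
    have [c Dc PE] := Pdiv q qI; exists (z - c * P ^+ k).
      by apply: subringB => //; apply: subringM => //; apply: subringX.
    by rewrite mulrBr -qz mulrA -PE -exprS addrK.
have inj_k : injective (fun k => 1 + P ^+ k.+1).
  have lt k l : (k < l)%N -> P ^+ k.+1 <> P ^+ l.+1.
    move=> kl; rewrite -(subnKC kl) -addnS exprD -[LHS]mulr1.
    move=> /(mulfI (expf_neq0 _ P0)) E.
    by apply: (XU (l - k.+1)%N); rewrite -E; exact: unit_in1.
  move=> k l /addrI kl; apply/eqP; case: ltngtP => // [/lt//|/lt]; by rewrite kl.
have : (size [seq (1 + P ^+ k.+1)%R | k <- iota 0 (size us).+1] <= size us)%N.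
  apply: uniq_leq_size; first by rewrite map_inj_uniq ?iota_uniq.
  by move=> _ /mapP[k _ ->]; exact: D_units.
by rewrite size_map size_iota ltnn.
Qed.

Lemma roots_in_seq (p : {poly K}) : p != 0 -> exists s : seq K, forall x, root p x -> x \in s.
Proof.
have [n] := ubnP (size p); elim: n p => // n IHn p /ltnSE-pn p0.
have [[a /factor_theorem[r rE]]|Np] := pselect (exists a, root p a); last first.
  by exists [::] => x px; case: Np; exists x.
have r0 : r != 0 by apply: contraNneq p0 => r0; rewrite rE r0 mul0r.
have [|s sr] := IHn r _ r0.
  by apply: leq_trans pn; rewrite rE size_Mmonic ?monicXsubC // size_XsubC addn2.
exists (a :: s) => x; rewrite rE rootM root_XsubC inE orbC.
by case/orP => [->//|/sr->]; rewrite orbT.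
Qed.

Lemma factor_irreducible_reprs x : x \in D -> x != 0 ->
  exists u (l : seq (irreducible_reprs D)), unit_in D u /\ x = u * \prod_(a <- l) set_val a.
Proof.
have [_ Dat _] := Dfact => Dx x0; have [u [s [uU sI ->]]] := Dat x Dx x0.
elim: s u uU sI => [|a s IHs] u uU sI.
  by exists u, [::]; rewrite !big_nil.
have [r rI [v vU rE]] := irreducible_reprs_associate Dring (sI a (mem_head _ _)).
have [||w [l [wU lE]]] := IHs (u * v^-1).
- by apply: unit_inM => //; exact: unit_inV.
- by move=> b bs; apply: sI; rewrite inE bs orbT.
have v0 := unit_in_neq0 vU.
exists w, (SigSub (mem_set rI) :: l); split=> //.
rewrite big_cons [in RHS]big_cons [RHS]mulrCA -lE.
have -> : set_val (SigSub (mem_set rI)) = v * a by rewrite -rE.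
rewrite [RHS]mulrACA.
by rewrite [v * _]mulrCA divff // mulr1.
Qed.

(** An element of [K] is determined by a polynomial over [D] and a position among its roots, and
    each coefficient by a unit and a list of irreducibles. The pairing and list injections compress
    these finite data into one irreducible. *)
Lemma card_le_irreducible_reprs : [set: K] #<= irreducible_reprs D.
Proof.
set I' := set_type (irreducible_reprs D).
have infI' : infinite_set [set: I'].
  by rewrite (eq_finite_set (card_setT _)); exact: infinite_irreducible_reprs.
have [p pI] := infinite_pairing infI'; have [sq sqI] := seq_inj_infinite infI'.
have [i iI] := infinite_nat_inj infI'.
(* Index 0 encodes the coefficient 0; the units are shifted to positive indices. *)
pose dec1 (c : nat * seq I') : K := nth 0 (0 :: us) c.1 * \prod_(a <- c.2) set_val a.
have /choice[enc1 enc1K] x : exists c, x \in D -> dec1 c = x.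
  have [Dx|] := boolP (x \in D); last by exists (0%N, [::]).
  have [->|x0] := eqVneq x 0; first by exists (0%N, [::]); rewrite /dec1 /= mul0r.
  have [u [l [uU ->]]] := factor_irreducible_reprs Dx x0.
  by exists ((index u us).+1, l); rewrite /dec1 /= nth_index // D_units.
have /choice[rts rtsP] (f : {poly K}) : exists s : seq K, f != 0 -> forall x, root f x -> x \in s.
  by have [->|/roots_in_seq[s sP]] := eqVneq f 0; [exists [::]|exists s].
pose dec2 (c : seq (nat * seq I') * nat) : K := nth 0 (rts (Poly (map dec1 c.1))) c.2.
have /choice[enc2 enc2K] x : exists c, dec2 c = x.
  have [f [/(subring_polyOverP Dring) fD f0 fx]] := Dalg x.
  exists (map enc1 f, index x (rts f)); rewrite /dec2 /= -map_comp.
  have -> : map (dec1 \o enc1) f = f.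
    by rewrite -[RHS]map_id; apply/eq_in_map => a /(nthP 0)[j _ <-] /=; exact: enc1K.
  by rewrite polyseqK nth_index // rtsP.
pose enc3 (c : seq (nat * seq I') * nat) : I' :=
  p (sq (map (fun b => p (i b.1, sq b.2)) c.1), i c.2).
have enc3I : injective enc3.
  move=> [l m] [l' m'] /pI[/sqI ll' /iI ->]; congr pair; apply: inj_map ll'.
  by move=> [a b] [a' b'] /pI[/iI-> /sqI->].
have FI : {in [set: K] &, injective (set_val \o enc3 \o enc2)}.
  by move=> x y _ _ /val_inj/enc3I/(congr1 dec2); rewrite !enc2K.
rewrite -(card_le_eql (inj_card_eq FI)); apply: subset_card_le => _ [x _ <-].
exact: set_valP.
Qed.

End FactorialCardinality.

(** * Non-isomorphic maximal subrings from non-associate irreducibles *)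

Theorem proposition3p10 (K : fieldType) (hK : ~ absolutely_algebraic K) :
  exists D : {pred K},
    [/\ is_UFD D,
        algebraic_over_subring D,
        (exists2 I : set K, is_Irr D I & I #= [set: K]) &
        (exists M : set {pred K},
          [/\ [set: K] #<= M,
              (forall S, M S -> maximal_subring S /\ {subset D <= S}) &
              (forall S T, M S -> M T -> S <> T ->
                ~ algebra_isomorphic D S T)])].
Proof.
have [D [Dfact PD Dalg]] := factorial_algebraic_extension (prime_subring_factorial K).
have [Dring _ _] := Dfact.
have [us usP] := unit_in_prime_subring_finite K.
have [d [Dd d0 dU]] := inert_exists_nonunit hK Dring PD Dalg.
have D_units x : unit_in D x -> x \in us.
  by move=> /(inert_unit (prime_subring_closed K) PD); exact: usP.
have KI := card_le_irreducible_reprs Dfact Dalg D_units Dd d0 dU.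
exists D; split=> //; first exact: factorial_is_UFD.
  exists (irreducible_reprs D); first exact: irreducible_reprs_is_Irr.
  by apply: Cantor_Bernstein => //; exact: card_leT.
have /choice[S SP] q : exists S : {pred K}, irreducible_in D q ->
    [/\ maximal_subring S, {subset D <= S}, q^-1 \notin S &
      forall r, irreducible_in D r -> ~ associates_in D q r -> r^-1 \in S].
  have [qI|] := pselect (irreducible_in D q); last by exists D.
  by have [S SP] := exists_maximal_subring_at Dfact Dalg qI; exists S.
have SV q r : irreducible_reprs D q -> irreducible_reprs D r -> q <> r -> r^-1 \in S q.
  move=> qI rI qr; have [_ _ _ ->//] := SP q qI.1; first exact: rI.1.
  by move=> /(irreducible_reprs_uniq Dring qI rI).
exists (S @` irreducible_reprs D); split.
- have SI : {in irreducible_reprs D &, injective S}.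
    move=> q r /set_mem qI /set_mem rI Sqr; apply: contrapT => /(SV _ _ qI rI).
    by rewrite Sqr; apply/negP; case: (SP r rI.1).
  by rewrite (card_le_eqr (inj_card_eq SI)).
- by move=> _ [q [qI _] <-]; case: (SP q qI).
- move=> _ _ [q qI <-] [r rI <-] Sqr [f [[fS _ _] _ fM fD]].
  have [_ DSq _ _] := SP q qI.1; have [_ _ SrV _] := SP r rI.1.
  (* An isomorphism over [D] fixes [r], hence also [r^-1], and would carry it from [S q] into
     [S r]. *)
  have rqV : r^-1 \in S q by apply: SV => // qr; apply: Sqr; rewrite qr.
  have [Dr r0 _ _] := rI.1.
  case/negP: SrV; have <- : f r^-1 = r^-1.
    apply: (mulfI r0); rewrite -{1}(fD r Dr) -fM //; last exact: DSq.
    by rewrite divff // fD // subring1.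
  exact: fS.
Qed.
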